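(* Let $\mathbf{Z}=(Z_i)_{i\in\mathbb{Z}}$ be a $\mathcal{Z}$-valued $\phi$-mixing process with mixing coefficients $\phi(k)$, and let $\Phi_n=\sum_{k=1}^n\phi(k)$. For each $n\geq1$ let $h_n:\mathcal{Z}\to[a_n,b_n]\subset\mathbb{R}$ be measurable with $\mathbb{E}[h_n(Z_i)]=\mu_n$ for every $i$, and let $\mathbb{P}_n(h_n)=\frac1n\sum_{i=1}^n h_n(Z_i)$. For any given $l>0$ (depending on $n$) such that $l\nearrow\infty$ as $n\to\infty$ and $l=o(\sqrt n)$, let $m=[\frac{n}{[l]}]$, and partition $\{1,\dots,n\}=\bigcup_{j=1}^{m+1}B_j$, where $B_j=\{(j-1)[l]+1,\dots,j[l]\}$ for $1\leq j\leq m$ and $B_{m+1}=\{m[l]+1,\dots,n\}$. Let $$\bar H_n=\frac{1}{m[l]}\sum_{i=1}^{m[l]}h_n(Z_i),\qquad \hat V_n=\frac1n\sum_{j=1}^m\Big(\sum_{i\in B_j}(h_n(Z_i)-\bar H_n)\Big)^2 .$$ Then, for arbitrary $\xi_n\searrow0$ and any given $\delta>0$, $n\geq1$, $$\mathbb{P}\left(\Big|\mathbb{P}_n(h_n)-\mu_n\Big|\leq\tilde\nu_n(\delta)(A_\phi+B_\phi)+\frac{n-m[l]}{n}(b_n-a_n)\right)\geq1-3\delta ,$$ where $$\tilde\nu_n(\delta)=\Big(1-\sqrt{\tfrac{2\log(\frac1\delta)}{m}}\Big)^{-1},\qquad B_\phi=\frac{(3.15[l]+2\Phi_n)(b_n-a_n)\log(\frac1\delta)}{n},$$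 $$A_\phi=\sqrt{2\log(\tfrac1\delta)\,\tfrac1n\hat V_n}+4(b_n-a_n)\Phi_n\sqrt{\frac{2\log(\frac1\delta)\,m}{n^2}}+\sqrt{\frac{2\log(\frac1\delta)\,\xi_n}{n^2}} .$$
   Context: $[x]$ denotes the integer part of $x$. $\mathcal{Z}$ is a Borel space and $\mathbf{Z}=(Z_i)_{i\in\mathbb{Z}}$ is a process on a probability space $(\Omega,\mathcal{F},\mathbb{P})$. $\mathcal{F}_a^b$ is the $\sigma$-algebra generated by the $Z_i$ with $i\in[a,b]$. The $\phi$-mixing coefficient is $$\phi(k)=\max_{n}\ \sup_{A\in\mathcal{F}_{-\infty}^n,\ \mathbb{P}(A)>0}\ \sup_{B\in\mathcal{F}_{k+n}^\infty}|\mathbb{P}(B\mid A)-\mathbb{P}(B)|,$$ and $\mathbf{Z}$ is $\phi$-mixing if $\phi(k)\to0$ as $k\to\infty$. No summability or rate of decay of $\phi(k)$ is assumed.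
   Formalization: The formal theorem additionally assumes 2 log(1/δ) < m, so that ν̃_n(δ) is finite and positive; otherwise ν̃_n(δ) is negative or undefined and the printed inequality fails (e.g. i.i.d. nonconstant case, n = l = m = 1, δ = 0.1). *)

(* Defs.v *)
From HB Require Import structures.
From mathcomp Require Import all_boot all_order all_algebra.
From mathcomp Require Import all_classical all_reals all_analysis.

Set Implicit Arguments.
Unset Strict Implicit.
Unset Printing Implicit Defensive.

Import Order.TTheory GRing.Theory Num.Theory.
Import numFieldNormedType.Exports.

Local Open Scope classical_set_scope.
Local Open Scope ring_scope.

Definition sigma_of_process d d' (T : measurableType d) (S : measurableType d')
    (Z : int -> T -> S) (I : interval int) : set (set T) :=
  <<s \bigcup_(i in [set` I]) preimage_set_system setT (Z i) measurable >>.

(* No stationarity is assumed, so the supremum also runs over the time [n].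
   The set of values contains 0 (take A = B = setT) and is bounded by 1, so
   the real-valued [sup] is the actual least upper bound. *)
Definition phi_coef d d' (T : measurableType d) (S : measurableType d')
    (R : realType) (P : probability T R) (Z : int -> T -> S) (k : nat) : R :=
  sup [set r : R | exists n : int, exists A B : set T,
    [/\ sigma_of_process Z `]-oo, n] A, (0 < P A)%E,
        sigma_of_process Z `[k%:Z + n, +oo[ B
      & r = `| fine (P (A `&` B)) / fine (P A) - fine (P B) | ] ].

Definition phi_mixing d d' (T : measurableType d) (S : measurableType d')
    (R : realType) (P : probability T R) (Z : int -> T -> S) : Prop :=
  phi_coef P Z k @[k --> \oo] --> (0 : R).

Definition Phi_sum d d' (T : measurableType d) (S : measurableType d')
    (R : realType) (P : probability T R) (Z : int -> T -> S) (n : nat) : R :=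
  \sum_(1 <= k < n.+1) phi_coef P Z k.

Section blocks.
Context d d' (T : measurableType d) (S : measurableType d') (R : realType).
Implicit Types (Z : int -> T -> S) (h : S -> R) (n L m j : nat) (t : T).

Definition emp_mean Z h n t : R := n%:R^-1 * \sum_(1 <= i < n.+1) h (Z i%:Z t).

Definition num_blocks n (l : R) : nat := n %/ Num.truncn l.

Definition block L j : seq nat := index_iota (j.-1 * L).+1 (j * L).+1.

Definition Hbar Z h n (l : R) t : R :=
  emp_mean Z h (num_blocks n l * Num.truncn l) t.

Definition Vhat Z h n (l : R) t : R :=
  n%:R^-1 * \sum_(1 <= j < (num_blocks n l).+1)
    (\sum_(i <- block (Num.truncn l) j) (h (Z i%:Z t) - Hbar Z h n l t)) ^+ 2.

(* This is the intended factor only when 2 log(1/delta) < m; otherwise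
   1 - sqrt(2 log(1/delta) / m) is nonpositive (or m = 0). *)
Definition nu_tilde n (l delta : R) : R :=
  (1 - Num.sqrt (2 * ln delta^-1 / (num_blocks n l)%:R))^-1.

Variable P : probability T R.

Definition A_phi Z h (a b : R) n (l xi delta : R) t : R :=
  Num.sqrt (2 * ln delta^-1 * (n%:R^-1 * Vhat Z h n l t))
  + 4 * (b - a) * Phi_sum P Z n
      * Num.sqrt (2 * ln delta^-1 * (num_blocks n l)%:R / n%:R ^+ 2)
  + Num.sqrt (2 * ln delta^-1 * xi / n%:R ^+ 2).

Definition B_phi Z (a b : R) n (l delta : R) : R :=
  ((315 / 100) * (Num.truncn l)%:R + 2 * Phi_sum P Z n)
    * (b - a) * ln delta^-1 / n%:R.

End blocks.

(* Main.v *)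
Require Import Defs.
From mathcomp Require Import all_boot all_order all_algebra.
From mathcomp Require Import all_classical all_reals all_analysis.
From mathcomp Require Import measurable_realfun ring lra.
Import Order.TTheory GRing.Theory Num.Theory.
Import numFieldNormedType.Exports.
Local Open Scope classical_set_scope.
Local Open Scope ring_scope.

(** Write [L] for the block length, [W = b - a], [ell = ln (1 / delta)],
    [y = sqrt (2 ell)], [M = sqrt m], and let [S_j] be the centred block sums,
    with total [S] and sum of squares [U].  Centring at the empirical mean
    instead of [mu] changes the sum of squares exactly by [S ^ 2 / m]
    (lemma [Vhat_block_sums]), so that
    [sqrt U <= sqrt (n Vhat) + |S| / M]; moving [y |S| / M] to the left-hand
    side produces the factor [nu_tilde] (lemma [studentized_bound]).  The
    incomplete last block is bounded by its number of terms times [W].  What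
    remains, for [delta < 1/3], is a self-normalized bound for [S], stated in units where
    [L W = 1] and with [p = Phi / L]:
    [|S| <= y sqrt U + 4 p y M + (3.1 + 2 p) ell] with probability at least
    [1 - 3 delta] (theorem [block_sum_concentration]).

    Martingale part.  Let [R_j] be the conditional mean, given the first [j]
    blocks, of the sum of the later ones.  Then [D_j = S_j + R_(j+1) - R_j]
    are martingale differences whose total is [S].  The mixing coefficients at
    increasing distances add up to [|R_j| <= p], so that no drift term
    appears, [|D_j| <= 1 + 2 p], and [Q = sum D_j ^ 2] satisfies
    [sqrt Q <= Z], where [Z = sqrt U + 2 p M].  From
    [exp (x - x ^ 2 / (2 (1 - l))) <= 1 + x] for [x >= - l] one obtains, for
    each fixed [Y > 0], that [S] exceeds
    [(1 + 2 p) ell + y Y / 2 + y Q / (2 Y)] with probability at most [delta],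
    and so does [- S].  Since
    [y Y / 2 + y Z ^ 2 / (2 Y) = y Z + y (Z - Y) ^ 2 / (2 Y)],
    this is the wanted bound as soon as the deterministic number [Y] is close enough
    to [Z]: [(Z - Y) ^ 2 <= (2.1 + 4 p) y Y] suffices.

    Localization of [U].  If [p >= 1/2], the trivial bound
    [Q <= m (1 + 2 p) ^ 2] with [Y = (1 + 2 p) M] is good enough.  If
    [p <= 1/2], then [U] is concentrated around its mean, in spite of the dependence:
    the summands [S_j ^ 2] lie in [[0, 1]], and past blocks change the conditional
    mean of the remaining sum by at most [1 + p], because the coefficients
    sampled every [L] steps add up to at most [1 + p].  This bounded
    compensator is inserted as a factor [1 + theta r_j] in the exponential
    moment (lemma [compensated_mgf]); it gives Bernstein tails for [U] on both
    sides, and these constrain [U] enough with one further probability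
    [delta].

    Reduction to finite spaces.  The values of [h] are rounded down to a grid
    of mesh [W / K].  The rounded process takes values in a finite set of
    words, where conditional means are finite averages; phi-mixing bounds the
    total variation between the conditional and unconditional laws of the
    future (lemma [mixing_covariance]).  The gap between 3.1 and 3.15 absorbs
    the rounding error once [K] is large. *)

Set Implicit Arguments.
Unset Strict Implicit.
Unset Printing Implicit Defensive.

(** * Exponential inequalities *)

Section elementary.
Context (R : realType).
Implicit Types (x l u s : R).

(** The sharp constant 1/2 as [l] tends to 0 is what gives the leading term
    [sqrt (2 ell U)] in the final bound. *)
Lemma expR_second_order l x : 0 <= l -> l < 1 -> - l <= x ->
  expR (x - x ^+ 2 / (2 * (1 - l))) <= 1 + x.
Proof.
move=> l0 l1 lx; have l10 : 0 < 1 - l by lra.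
have [k kE] : exists k, k = (2 * (1 - l))^-1 by eexists.
have hk : 2 * k * (1 - l) = 1 by rewrite kE; field; lra.
have k0 : 0 < k by rewrite kE invr_gt0; lra.
(* g has its minimum at 0, as dg has the sign of its argument on [-l, +oo[ *)
pose g y : R := (1 + y) * expR (k * y ^+ 2 - y).
pose dg y : R := y * (2 * k * (1 + y) - 1) * expR (k * y ^+ 2 - y).
have gd y : is_derive y (1 : R) g (dg y).
  have h1 : is_derive y (1 : R) (fun z : R => k * z ^+ 2 - z) (2 * k * y - 1).
    by apply: is_derive_eq; rewrite /GRing.scale /=; ring.
  have h2 : is_derive y (1 : R) (fun z : R => expR (k * z ^+ 2 - z))
     ((2 * k * y - 1) * expR (k * y ^+ 2 - y)).
    apply: is_derive_eq; rewrite /GRing.scale /=; ring.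
  rewrite /g; apply: is_derive_eq; rewrite /dg /GRing.scale /=; ring.
have gc : continuous g.
  by move=> y; apply: differentiable_continuous; apply/derivable1_diffP; have [] := gd y.
have dg_ge y : - l <= y -> 0 <= dg y * y.
  move=> ly.
  have -> : dg y * y = y ^+ 2 * (2 * k * (l + y)) * expR (k * y ^+ 2 - y).
    rewrite /dg; have -> : 2 * k * (1 + y) - 1 = 2 * k * (l + y)
      by rewrite -[X in _ - X = _]hk; ring.
    by ring.
  apply: mulr_ge0 (expR_ge0 _); apply: mulr_ge0 (sqr_ge0 _) _.
  by apply: mulr_ge0; [exact: mulr_ge0 (ltW k0)|rewrite -lerBlDl sub0r].
have g0 : g 0 = 1 by rewrite /g expr0n /= mulr0 subr0 expR0; lra.
have g1 : 1 <= g x.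
  have [x0|x0] := leP 0 x.
    have [c] := MVT_segment x0 (fun y _ => gd y) (continuous_subspaceT gc).
    rewrite in_itv /= => /andP[c0 cx]; rewrite g0 subr0 => e.
    suff : 0 <= dg c * x by lra.
    have [->|cn0] := eqVneq c 0; first by rewrite /dg !mul0r.
    have cp : 0 < c by rewrite lt_neqAle eq_sym cn0.
    have lc : - l <= c by lra.
    have := dg_ge c lc; nra.
  have [c] := MVT_segment (ltW x0) (fun y _ => gd y) (continuous_subspaceT gc).
  rewrite in_itv /= => /andP[xc c0]; rewrite g0 sub0r => e.
  have := dg_ge c (le_trans lx xc) => h.
  have [c00|cn0] := eqVneq c 0; first by move: e; rewrite c00 /dg !mul0r; lra.
  have cp : c < 0 by rewrite lt_neqAle cn0.
  suff : dg c * - x <= 0 by lra.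
  nra.
have -> : x - x ^+ 2 / (2 * (1 - l)) = - (k * x ^+ 2 - x) by rewrite -kE; ring.
by rewrite expRN -[leLHS]mul1r ler_pdivrMr ?expR_gt0.
Qed.

(** These two inequalities linearize the exponential of a variable with values
    in [[0, 1]] at the price of a second order correction of the exponent. *)
Lemma expR_le_1Dmul s u : 0 <= s -> 0 <= u <= 1 ->
  expR (u * (s * (1 - s / 2))) <= 1 + s * u.
Proof.
move=> s0 /andP[u0 u1].
have su0 : - (0 : R) <= s * u by rewrite oppr0 mulr_ge0.
apply: le_trans (expR_second_order (lexx _) ltr01 su0).
rewrite ler_expR subr0 mulr1.
have -> : u * (s * (1 - s / 2)) = s * u - s ^+ 2 * u / 2 by field.
rewrite lerB // ler_pM2r // exprMn ler_wpM2l ?sqr_ge0 //; nra.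
Qed.

Lemma expR_le_1Bmul s u : 0 <= s -> s < 1 -> 0 <= u <= 1 ->
  expR (- u * (s * (1 - s / 2) / (1 - s))) <= 1 - s * u.
Proof.
move=> s0 s1 /andP[u0 u1].
have su0 : - s <= - (s * u) by rewrite lerN2; nra.
apply: le_trans (expR_second_order s0 s1 su0).
rewrite ler_expR.
have -> : - u * (s * (1 - s / 2) / (1 - s)) =
  - (s * u) - s ^+ 2 * u / (2 * (1 - s)) by field; lra.
rewrite lerB // ler_pM2r ?invr_gt0; last by lra.
rewrite sqrrN exprMn ler_wpM2l ?sqr_ge0 //; nra.
Qed.
End elementary.

(** * Finite probability spaces and conditional means *)

Section finite_probability.
Context (R : realType) (Om : finType) (C : eqType) (w : Om -> R).
Context (w_ge0 : forall x, 0 <= w x).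
Implicit Types (f g : Om -> R) (c : Om -> C).

Definition mean f : R := \sum_x w x * f x.

Definition mass (A : pred Om) : R := \sum_(x | A x) w x.

(** The conditional mean given the partition into level sets of [c]; it is 0 on
    level sets of mass 0. *)
Definition cond_mean c f x : R :=
  (\sum_(y | c y == c x) w y * f y) / mass (fun y => c y == c x).

Definition adapted (V : Type) c (f : Om -> V) :=
  forall x y, c x = c y -> f x = f y.

Lemma mass_ge0 A : 0 <= mass A.
Proof. exact: sumr_ge0. Qed.

Lemma mass_sub (A B : pred Om) : {subset A <= B} -> mass A <= mass B.
Proof.
move=> AB; rewrite /mass [leRHS](bigID A) /=.
rewrite [X in _ <= X + _](eq_bigl A) ?lerDl ?sumr_ge0 // => x.
by rewrite andbC; case: (boolP (A x)) => // /AB; rewrite unfold_in => ->.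
Qed.

Lemma mass_setU (A B : pred Om) : mass (predU A B) <= mass A + mass B.
Proof.
rewrite /mass (bigID A) /=; apply: lerD.
  by rewrite le_eqVlt; apply/orP; left; apply/eqP; apply: eq_bigl => x; rewrite /=; case: (A x); rewrite ?andbF.
by apply: mass_sub => x /=; rewrite !unfold_in /= => /andP[/orP[->//|//]].
Qed.

Lemma ler_mean f g : (forall x, f x <= g x) -> mean f <= mean g.
Proof. by move=> fg; apply: ler_sum => x _; rewrite ler_wpM2l. Qed.

Lemma mean_ge0 f : (forall x, 0 <= f x) -> 0 <= mean f.
Proof. by move=> f0; apply: sumr_ge0 => x _; rewrite mulr_ge0. Qed.

Lemma meanD f g : mean (fun x => f x + g x) = mean f + mean g.
Proof. by rewrite -big_split /=; apply: eq_bigr => x _; rewrite mulrDr. Qed.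

Lemma meanZ k f : mean (fun x => k * f x) = k * mean f.
Proof. by rewrite /mean mulr_sumr; apply: eq_bigr => x _; rewrite mulrCA. Qed.

Lemma eq_mean f g : f =1 g -> mean f = mean g.
Proof. by move=> fg; apply: eq_bigr => x _; rewrite fg. Qed.

Lemma mean_cst a : \sum_x w x = 1 -> mean (fun=> a) = a.
Proof. by move=> w1; rewrite /mean -mulr_suml w1 mul1r. Qed.

Lemma mean_sum i j (f : nat -> Om -> R) :
  mean (fun x => \sum_(i <= k < j) f k x) = \sum_(i <= k < j) mean (f k).
Proof.
by rewrite /mean exchange_big /=; apply: eq_bigr => x _; rewrite mulr_sumr.
Qed.

Lemma mass_ge_le_mean f t : 0 < t -> (forall x, 0 <= f x) ->
  mass (fun x => t <= f x) <= mean f / t.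
Proof.
move=> t0 f0; rewrite ler_pdivlMr // /mass mulr_suml.
rewrite /mean [leRHS](bigID (fun x => t <= f x)) /= -[leLHS]addr0.
apply: lerD.
  by apply: ler_sum => x tx; rewrite ler_wpM2l.
by apply: sumr_ge0 => x _; rewrite mulr_ge0.
Qed.

Lemma cond_mean_adapted c f : adapted c (cond_mean c f).
Proof. by move=> x y e; rewrite /cond_mean e. Qed.

(** The martingale properties below are stated by testing against adapted
    functions, so that this identity is all that their proofs use of
    conditional means. *)
Lemma mean_cond_mean c f g : adapted c g ->
  mean (fun x => g x * cond_mean c f x) = mean (fun x => g x * f x).
Proof.
move=> cg; pose ms x := mass (fun y => c y == c x).
transitivity (\sum_x \sum_(y | c y == c x) w x * g x * (w y * f y) / ms x).
  apply: eq_bigr => x _; rewrite /cond_mean -/(ms x) mulrA mulrA mulr_sumr mulr_suml.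
  by apply: eq_bigr => y _.
rewrite (exchange_big_dep predT) //=; apply: eq_bigr => y _.
transitivity (\sum_(x | c x == c y) w x * (g y * (w y * f y) / ms y)).
  apply: eq_big => [x|x /eqP e]; first by rewrite eq_sym.
  by rewrite (cg x y) // /ms e -!mulrA.
rewrite -mulr_suml -[X in X * _]/(ms y).
have [ms0|msn0] := eqVneq (ms y) 0; last by field.
suff -> : w y = 0 by rewrite !(mul0r, mulr0).
apply/eqP; rewrite eq_le w_ge0 andbT -ms0 /ms /mass (bigD1 y) //= lerDl.
exact: sumr_ge0.
Qed.
End finite_probability.

(** * Exponential supermartingales *)

Section filtered_space.
Context (R : realType) (Om : finType) (C : eqType) (w : Om -> R).
Context (w_ge0 : forall x, 0 <= w x) (w_sum1 : \sum_x w x = 1).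
Context (m : nat) (c : nat -> Om -> C).
Context (c_refine : forall j x y, c j.+1 x = c j.+1 y -> c j x = c j y).
Implicit Types (f g : Om -> R) (D U r : nat -> Om -> R) (rho s k lam ell : R).

Lemma adapted_le i j f : (i <= j)%N -> adapted (c i) f -> adapted (c j) f.
Proof.
move=> ij cf x y e; apply: cf; elim: j ij e => [|j IH].
  by rewrite leqn0 => /eqP ->.
rewrite leq_eqVlt => /orP[/eqP-> //|]; rewrite ltnS => ij /c_refine; exact: IH.
Qed.

Lemma adapted_sum U j : (forall i, (i < j)%N -> adapted (c i.+1) (U i)) ->
  adapted (c j) (fun x => \sum_(0 <= i < j) U i x).
Proof.
move=> cU x y e; apply: eq_big_nat => i /andP[_ ij].
exact: (adapted_le ij (cU i ij)).
Qed.

(** The quadratic term of the exponent uses the realized squares [D i x ^+ 2]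
    instead of their conditional means.  Hence no predictable bound on the
    variance is required, and [expR_second_order] makes each factor at most
    [1 + lam * D i x], which has conditional mean 1. *)
Lemma selfnormalized_mgf D k lam :
  (forall j, (j < m)%N -> adapted (c j.+1) (D j)) ->
  (forall j g, (j < m)%N -> adapted (c j) g ->
     mean w (fun x => g x * D j x) = 0) ->
  (forall j x, (j < m)%N -> - k <= D j x) ->
  0 <= lam -> 0 <= k -> lam * k < 1 ->
  mean w (fun x => expR (lam * (\sum_(0 <= i < m) D i x)
     - lam ^+ 2 / (2 * (1 - lam * k)) * (\sum_(0 <= i < m) D i x ^+ 2))) <= 1.
Proof.
move=> cD D0 Dk lam0 k0 lamk.
pose G j x := expR (lam * (\sum_(0 <= i < j) D i x)
     - lam ^+ 2 / (2 * (1 - lam * k)) * (\sum_(0 <= i < j) D i x ^+ 2)).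
suff H j : (j <= m)%N -> mean w (G j) <= 1 by exact: (H m (leqnn m)).
elim: j => [_|j IH jm].
  rewrite (@eq_mean _ _ _ _ (fun=> 1)) ?mean_cst // => x.
  by rewrite /G !big_geq // !mulr0 subr0 expR0.
apply: le_trans (IH (ltnW jm)).
have cG : adapted (c j) (G j).
  move=> x y e.
  have e1 : \sum_(0 <= i < j) D i x = \sum_(0 <= i < j) D i y.
    by apply: adapted_sum e => i ij; exact: cD (ltn_trans ij jm).
  have e2 : \sum_(0 <= i < j) D i x ^+ 2 = \sum_(0 <= i < j) D i y ^+ 2.
    apply: (@adapted_sum (fun i z => D i z ^+ 2)) e => i ij u v E.
    by rewrite (cD i (ltn_trans ij jm) u v E).
  by rewrite /G e1 e2.
have -> : mean w (G j) = mean w (fun x => G j x * (1 + lam * D j x)).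
  rewrite (@eq_mean _ _ _ (fun x => G j x * (1 + lam * D j x))
    (fun x => G j x + lam * (G j x * D j x))); last by move=> x; ring.
  by rewrite meanD meanZ D0 // mulr0 addr0.
apply: ler_mean => // x.
have -> : G j.+1 x = G j x *
    expR (lam * D j x - (lam * D j x) ^+ 2 / (2 * (1 - lam * k))).
  by rewrite -expRD /G !big_nat_recr //=; congr expR; field; lra.
rewrite ler_wpM2l ?expR_ge0 //; apply: expR_second_order => //.
- exact: mulr_ge0.
- by rewrite -mulrN ler_wpM2l // Dk.
Qed.

Lemma selfnormalized_tail D k lam ell :
  (forall j, (j < m)%N -> adapted (c j.+1) (D j)) ->
  (forall j g, (j < m)%N -> adapted (c j) g ->
     mean w (fun x => g x * D j x) = 0) ->
  (forall j x, (j < m)%N -> - k <= D j x) ->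
  0 < lam -> 0 <= k -> lam * k < 1 ->
  mass w (fun x => ell / lam + lam / (2 * (1 - lam * k))
        * (\sum_(0 <= i < m) D i x ^+ 2) < \sum_(0 <= i < m) D i x)
    <= expR (- ell).
Proof.
move=> cD D0 Dk lam0 k0 lamk.
have := selfnormalized_mgf cD D0 Dk (ltW lam0) k0 lamk.
set f := fun x => expR _ => mf.
have := mass_ge_le_mean w_ge0 (expR_gt0 ell) (fun x => expR_ge0 _ : 0 <= f x).
rewrite -expRN => mk; apply: (@le_trans _ _ (mass w (fun x => expR ell <= f x))).
  apply: mass_sub => // x; rewrite !unfold_in => h.
  have e : ell = lam * (ell / lam) by field; lra.
  rewrite /f ler_expR [leLHS]e.
  have -> : lam ^+ 2 / (2 * (1 - lam * k)) = lam * (lam / (2 * (1 - lam * k))).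
    by field; lra.
  rewrite -mulrA -mulrBr ler_wpM2l ?(ltW lam0) // lerBrDr; exact: ltW.
by apply: le_trans mk _; rewrite ler_piMl ?expR_ge0.
Qed.

(** Here [r j] stands for the conditional mean, given the first [j] steps, of
    the sum of the later [U i - v i].  The process
    [\prod_(i < j) (1 + s * U i) * (1 + th * r j)] with
    [th = s / (1 - rho * s)], divided by [expR (K * \sum_(i < j) v i)] with
    [K = s / (1 - 2 * rho * s)], is a supermartingale: the compensator [r]
    replaces [U j] by its mean [v j] even though the conditional mean of [U j]
    is not close to [v j].  Both signs of [s] are treated at once, because
    [th] has the sign of [s]. *)
Lemma compensated_mgf U r (v : nat -> R) rho s :
  (forall j, (j < m)%N -> adapted (c j.+1) (U j)) ->
  (forall j x, (j < m)%N -> 0 <= U j x <= 1) ->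
  (forall j, (j < m)%N -> 0 <= v j) ->
  (forall j x, (j <= m)%N -> `| r j x | <= rho) ->
  (forall x, r 0%N x = 0) -> (forall x, r m x = 0) ->
  (forall j g, (j < m)%N -> adapted (c j) g ->
     mean w (fun x => g x * (U j x + r j.+1 x - r j x)) = v j * mean w g) ->
  0 <= rho -> - 1 <= s -> 2 * rho * s < 1 ->
  mean w (fun x => \prod_(0 <= i < m) (1 + s * U i x)) <=
    expR (s / (1 - 2 * rho * s) * \sum_(0 <= i < m) v i).
Proof.
move=> cU U01 v0 r_le r0 rm rE rho0 s1 rhos.
have [th thd] : exists th : R, th = s / (1 - rho * s) by eexists.
set K := s / (1 - 2 * rho * s).
have d0 : 0 < 1 - rho * s by nra.
(* th is chosen so that the terms linear in U j cancel *)
have thE : th = s * (1 + th * rho) by rewrite thd; field; lra.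
have th1 : 0 < 1 - th * rho.
  have -> : 1 - th * rho = (1 - 2 * rho * s) / (1 - rho * s).
    by rewrite thd; field; lra.
  by rewrite divr_gt0 //; lra.
have th2 : 0 < 1 + th * rho.
  have -> : 1 + th * rho = 1 / (1 - rho * s).
    by rewrite thd; field; lra.
  by rewrite divr_gt0 //; lra.
have KE : th = K * (1 - th * rho) by rewrite thd /K; field; lra.
pose P j x := \prod_(0 <= i < j) (1 + s * U i x).
have P_ge0 j x : (j <= m)%N -> 0 <= P j x.
  move=> jm; rewrite /P big_nat; apply: prodr_ge0 => i /andP[_ ij].
  have /andP[? ?] := U01 i x (leq_trans ij jm); nra.
have thr j x : (j <= m)%N -> 0 <= 1 + th * r j x.
  move=> jm; have := r_le j x jm; rewrite ler_norml => /andP[].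
  by move: (r j x) => q q1 q2; have [h|h] := leP 0 th; nra.
suff H j : (j <= m)%N -> mean w (fun x => P j x * (1 + th * r j x))
    <= expR (K * \sum_(0 <= i < j) v i).
  have := H m (leqnn m); rewrite (@eq_mean _ _ _ _ (P m)) // => x.
  by rewrite rm mulr0 addr0 mulr1.
elim: j => [_|j IH jm].
  rewrite (@eq_mean _ _ _ _ (fun=> 1)) ?mean_cst // ?big_geq ?mulr0 ?expR0 // => x.
  by rewrite /P big_geq // r0 mulr0 addr0 mulr1.
rewrite big_nat_recr //= mulrDr expRD.
have cP : adapted (c j) (P j).
  move=> x y e; apply: eq_big_nat => i /andP[_ ij].
  by rewrite (adapted_le ij (cU i (ltn_trans ij jm)) e).
have E0 : 0 <= mean w (fun x => P j x * (1 + th * r j x)).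
  by apply: mean_ge0 => // x; rewrite mulr_ge0 ?P_ge0 ?thr // ltnW.
apply: (@le_trans _ _ (mean w (fun x => P j x * (1 + th * r j x))
   * (1 + K * v j))); last first.
  apply: (@le_trans _ _ (mean w (fun x => P j x * (1 + th * r j x))
     * expR (K * v j))); first by rewrite ler_wpM2l // expR_ge1Dx.
  by rewrite ler_wpM2r ?expR_ge0 // IH // ltnW.
apply: (@le_trans _ _ (mean w (fun x => P j x * (1 + th * r j x)
    + th * (P j x * (U j x + r j.+1 x - r j x))))).
  apply: ler_mean => // x.
  have -> : P j.+1 x = P j x * (1 + s * U j x) by rewrite /P big_nat_recr.
  have -> : P j x * (1 + th * r j x) + th * (P j x * (U j x + r j.+1 x - r j x))
    = P j x * (1 + th * (U j x + r j.+1 x)) by ring.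
  rewrite -mulrA ler_wpM2l ?P_ge0 ?(ltnW jm) //.
  have /andP[u0 u1] := U01 j x jm.
  have := r_le j.+1 x jm; rewrite ler_norml => /andP[_ rr].
  have -> : 1 + th * (U j x + r j.+1 x) =
     (1 + s * U j x) * (1 + th * r j.+1 x) +
       s * th * (rho - r j.+1 x) * U j x + (th - s * (1 + th * rho)) * U j x by ring.
  rewrite -thE subrr mul0r addr0 lerDl mulr_ge0 // mulr_ge0 ?subr_ge0 //.
  by rewrite [X in _ * X]thd mulrA divr_ge0 ?(ltW d0) // -expr2 sqr_ge0.
rewrite meanD meanZ rE //.
rewrite mulrDr mulr1 lerD2l.
have -> : th * (v j * mean w (P j)) = v j * K * ((1 - th * rho) * mean w (P j)).
  by rewrite [in LHS]KE; ring.
rewrite [leRHS]mulrC (mulrC K) -subr_ge0 -mulrBr -mulrA mulr_ge0 ?v0 //.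
have -> : mean w (fun x => P j x * (1 + th * r j x)) - (1 - th * rho) * mean w (P j)
    = th * mean w (fun x => P j x * (rho + r j x)).
  rewrite -meanZ -mulNr -meanZ -meanD; apply: eq_mean => x; ring.
rewrite mulrA mulr_ge0 //.
  by rewrite KE mulrA mulr_ge0 ?(ltW th1) // -expr2 sqr_ge0.
apply: mean_ge0 => // x; rewrite mulr_ge0 ?P_ge0 ?(ltnW jm) //.
by have := r_le j x (ltnW jm); rewrite ler_norml => /andP[? _]; lra.
Qed.
End filtered_space.

(** * Choice of the localization window *)

Section numerics.
Context (R : realType).
Implicit Types (p v y sg U V : R).

(** In this section [y = sqrt (2 ell)], [V] is the mean of the sum of squares
    [U], and [v = sqrt V / y].  The hypotheses on [U] are the complements of
    the tail events of [U] for a suitable parameter [sg]; the conclusions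
    place [sqrt U] in a window that does not depend on [U].

    When [v <= 3 + 2 p], only an upper bound is required: the window
    from 0 to [2 (2.1 + 4 p) y] is centred at [(2.1 + 4 p) y], where this is
    an admissible half-width. *)
Lemma fluctuation_small_variance p y U V :
  0 <= p -> p <= 1 / 2 -> V <= (3 + 2 * p) ^+ 2 * y ^+ 2 ->
  1 / 10 * (1 - 1 / 10 / 2) * U <
     1 / 10 / (1 - 2 * (1 + p) * (1 / 10)) * V + y ^+ 2 / 2 ->
  U <= (2 * (21 / 10 + 4 * p) * y) ^+ 2.
Proof.
move=> p0 p1 hV.
set D := 1 - 2 * (1 + p) * (1 / 10) => hU.
have d0 : 0 < D by rewrite /D; lra.
have hV2 : 1 / 10 / D * V <= 1 / 10 / D * ((3 + 2 * p) ^+ 2 * y ^+ 2).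
  by rewrite ler_wpM2l // divr_ge0 ?(ltW d0) //; lra.
rewrite exprMn; have := sqr_ge0 y; move: (y ^+ 2) hV hV2 hU => z _ h1 h2 z0.
have h3 : 1 / 10 * (3 + 2 * p) ^+ 2 / D <= 95 / 1000 * (2 * (21 / 10 + 4 * p)) ^+ 2 - 1 / 2.
  by rewrite ler_pdivrMr // /D; nra.
have h4 : 1 / 10 / D * ((3 + 2 * p) ^+ 2 * z) <=
  (95 / 1000 * (2 * (21 / 10 + 4 * p)) ^+ 2 - 1 / 2) * z.
  by rewrite mulrA ler_wpM2r // mulrAC.
nra.
Qed.

(** When [v >= 3], the upper deviation of [sqrt U] is at most [5/2 y]
    whatever [v] is.  The level [5/6 y ^+ 2 = 5/3 ell] is that of an event of
    probability at most [delta / 2] when [delta < 1/3]; the parameter [sg] approximates the optimal one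
    in Bernstein's inequality with [rho = 3/2]. *)
Lemma fluctuation_upper v y U : 3 <= v -> 0 < y ->
  let sg := (7 / 2 + 2 * v)^-1 in
  sg * (1 - sg / 2) * U <
    sg / (1 - 2 * (3 / 2) * sg) * (v * y) ^+ 2 + 5 / 6 * y ^+ 2 ->
  U <= ((v + 5 / 2) * y) ^+ 2.
Proof.
move=> v3 y0 sg; set q := 7 / 2 + 2 * v in sg *.
have q0 : 0 < q by rewrite /q; lra.
have -> : sg * (1 - sg / 2) * U = (q - 1 / 2) * (U / q ^+ 2).
  by rewrite /sg; field; lra.
have -> : sg / (1 - 2 * (3 / 2) * sg) = 1 / (q - 3).
  by rewrite /sg; field; rewrite /q; lra.
rewrite !exprMn; have := sqr_ge0 y; move: (y ^+ 2) => z z0 h.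
have q3 : 0 < q - 3 by rewrite /q; lra.
have h1 : (v ^+ 2 / (q - 3) + 5 / 6) * q ^+ 2 <= (q - 1 / 2) * (v + 5 / 2) ^+ 2.
  rewrite mulrDl mulrAC -lerBrDr ler_pdivrMr // /q; nra.
have h2 : (q - 1 / 2) * U < (v ^+ 2 / (q - 3) + 5 / 6) * q ^+ 2 * z.
  have := h; rewrite -(ltr_pM2r (exprn_gt0 2 q0)).
  have -> : (q - 1 / 2) * (U / q ^+ 2) * q ^+ 2 = (q - 1 / 2) * U by field; lra.
  have -> // : (1 / (q - 3) * (v ^+ 2 * z) + 5 / 6 * z) * q ^+ 2 = (v ^+ 2 / (q - 3) + 5 / 6) * q ^+ 2 * z.
  by ring.
have h3 := ler_wpM2r z0 h1.
have q1 : 0 < q - 1 / 2 by rewrite /q; lra.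
rewrite -(ler_pM2l q1); lra.
Qed.

(** Optimizing over [sg] with [rho = 1 + p] would give the deviation
    [2 sqrt (5/6 (5/2 + 2 p)) v] of [U / y ^+ 2] below [v ^+ 2]; the constant
    [al] is an upper bound of this square root that is linear in [p]. *)
Lemma fluctuation_lower p v y U :
  0 <= p -> p <= 1 / 2 -> 3 + 2 * p <= v -> 0 < y ->
  let al := 1444 / 1000 + 58 / 100 * p in
  let sg := 5 / 6 / (al * v) in
  sg / (1 + 2 * (1 + p) * sg) * (v * y) ^+ 2 - 5 / 6 * y ^+ 2 <
    sg * (1 - sg / 2) / (1 - sg) * U ->
  (v ^+ 2 - 2 * al * v) * y ^+ 2 <= U.
Proof.
move=> p0 p1 v3 y0 al sg.
have al0 : 1 <= al by rewrite /al; lra.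
have v0 : 0 < v by lra.
have sv : sg * (al * v) = 5 / 6 by rewrite /sg divfK // gt_eqF // mulr_gt0 //; lra.
have s0 : 0 < sg by rewrite /sg divr_gt0 ?mulr_gt0 //; lra.
have s1 : sg < 1 by rewrite /sg ltr_pdivrMr ?mulr_gt0 //; nra.
rewrite exprMn; have := sqr_ge0 y; move: (y ^+ 2) => z z0.
have d1 : 0 < 1 + 2 * (1 + p) * sg by nra.
have alE : al = 1444 / 1000 + 58 / 100 * p by [].
clearbody sg al.
pose A := 2 * (1 + p) + 1 / 2; pose g := (1 - sg) / (sg * (1 - sg / 2)).
have g0 : 0 < g by rewrite /g divr_gt0 ?mulr_gt0 //; lra.
have g1 : g * (5 / 6) <= al * v.
  have -> : al * v = 1 / sg * (5 / 6) by rewrite -sv; field; lra.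
  rewrite ler_wpM2r // /g ler_pdivrMr ?mulr_gt0 //; last by lra.
  by rewrite mulrA div1r mulVf ?gt_eqF // mul1r; lra.
have g2 : 1 - A * sg <= g * (sg / (1 + 2 * (1 + p) * sg)).
  have -> : g * (sg / (1 + 2 * (1 + p) * sg)) =
     (1 - sg) / ((1 - sg / 2) * (1 + 2 * (1 + p) * sg)) by rewrite /g; field; lra.
  rewrite ler_pdivlMr ?mulr_gt0 //; last by lra.
  have -> : (1 - A * sg) * ((1 - sg / 2) * (1 + 2 * (1 + p) * sg)) =
     1 - sg - sg ^+ 2 * (19 / 4 + 9 * p + 4 * p ^+ 2 - A * (1 + p) * sg).
    by rewrite /A; field.
  rewrite gerBl mulr_ge0 ?sqr_ge0 //.
  by rewrite /A; nra.
have g3 : A * sg * v ^+ 2 <= al * v.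
  have -> : A * sg * v ^+ 2 = A * (5 / 6) / al * v by rewrite -sv; field; lra.
  by rewrite ler_wpM2r ?(ltW v0) // ler_pdivrMr ?(lt_le_trans _ al0) // /A alE; nra.
move=> h; have := h; rewrite -(ltr_pM2l g0).
have -> : g * (sg * (1 - sg / 2) / (1 - sg) * U) = U by rewrite /g; field; lra.
move=> h'; apply: le_trans (ltW h').
have -> : g * (sg / (1 + 2 * (1 + p) * sg) * (v ^+ 2 * z) - 5 / 6 * z) =
  (g * (sg / (1 + 2 * (1 + p) * sg)) * v ^+ 2 - g * (5 / 6)) * z by ring.
rewrite ler_wpM2r //.
have := ler_wpM2r (sqr_ge0 v) g2; lra.
Qed.

(** For [t < v] the last hypothesis reads [(v - t) (v + t) <= 2 al v]; the
    constants are such that [e = al + (2.1 + 4 p) / 2] satisfies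
    [e ^+ 2 <= (2.1 + 4 p) v] for [v >= 3 + 2 p], and a deviation larger than
    [e] is then excluded. *)
Lemma fluctuation_window p v t :
  0 <= p -> 3 + 2 * p <= v -> 0 <= t -> t <= v + 5 / 2 ->
  v ^+ 2 - 2 * (1444 / 1000 + 58 / 100 * p) * v <= t ^+ 2 ->
  (t - v) ^+ 2 <= (21 / 10 + 4 * p) * v.
Proof.
move=> p0 v3 t0 tv lo.
have [vt|tv0] := leP v t; first nra.
set q := 21 / 10 + 4 * p.
pose e : R := 1444 / 1000 + 58 / 100 * p + q / 2.
have eq : e ^+ 2 <= q * v.
  apply: (@le_trans _ _ (q * (3 + 2 * p))); first by rewrite /e /q; nra.
  by rewrite ler_wpM2l // /q; lra.
rewrite leNgt; apply/negP => h.
have e0 : 0 < e by rewrite /e /q; lra.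
have ed : e < v - t.
  rewrite -(ltr_pXn2r (n := 2)) ?nnegrE ?(ltW e0) ?subr_ge0 ?(ltW tv0) //.
  by apply: le_lt_trans eq _; rewrite -[ltRHS]sqrrN opprB.
have : 0 < (v - t - e) * (v + t - e) by rewrite mulr_gt0 // subr_gt0; lra.
have : e * 2 = 2 * (1444 / 1000 + 58 / 100 * p) + q by rewrite /e; lra.
nra.
Qed.
End numerics.

(** * Deterministic estimates for sums of squares *)

Section sums.
Context (R : realType).
Implicit Types (x a : nat -> R) (e : R).

Lemma sum_norm_le_sqrt m x :
  \sum_(0 <= i < m) `|x i| <=
    Num.sqrt m%:R * Num.sqrt (\sum_(0 <= i < m) x i ^+ 2).
Proof.
have X0 n : 0 <= \sum_(0 <= i < n) x i ^+ 2 by apply: sumr_ge0 => i _; exact: sqr_ge0.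
have A0 n : 0 <= \sum_(0 <= i < n) `|x i| by exact: sumr_ge0.
rewrite -sqrtrM ?ler0n // -[leLHS]ger0_norm // -sqrtr_sqr ler_wsqrtr //.
elim: m => [|m IH]; first by rewrite !big_geq // expr0n /= mul0r.
rewrite !big_nat_recr //=; move: IH (X0 m) (A0 m).
move: (\sum_(0 <= i < m) _) (\sum_(0 <= i < m) _) => X A IH hX hA.
rewrite -natr1 -[x m ^+ 2]real_normK ?num_real //.
have := normr_ge0 (x m); move: `|x m| => b b0.
suff : 2 * A * b <= X + m%:R * b ^+ 2 by nra.
have [m0|m0] := posnP m.
  have A00 : A = 0.
    by apply/eqP; rewrite -sqrf_eq0 eq_le sqr_ge0 andbT; move: IH; rewrite m0 mul0r.
  by rewrite A00 m0 mulr0 !mul0r addr0.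
have {}m0 : (0 : R) < m%:R by rewrite ltr0n.
move: (m%:R : R) m0 IH => M M0 IH.
rewrite -(ler_pM2l M0); have := sqr_ge0 (A - M * b); nra.
Qed.

(** The triangle inequality for the Euclidean norm of [R ^ m]. *)
Lemma sqrt_sum_sqr_shift m x a e : 0 <= e ->
  (forall i, (i < m)%N -> `|a i| <= e) ->
  Num.sqrt (\sum_(0 <= i < m) (x i + a i) ^+ 2) <=
    Num.sqrt (\sum_(0 <= i < m) x i ^+ 2) + e * Num.sqrt m%:R.
Proof.
move=> e0 ae; have X0 : 0 <= \sum_(0 <= i < m) x i ^+ 2.
  by apply: sumr_ge0 => i _; exact: sqr_ge0.
rewrite -[leRHS]ger0_norm ?addr_ge0 ?mulr_ge0 ?sqrtr_ge0 //.
rewrite -[leRHS]sqrtr_sqr ler_wsqrtr // sqrrD exprMn !sqr_sqrtr ?ler0n //.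
apply: (@le_trans _ _ (\sum_(0 <= i < m) (x i ^+ 2 + 2 * e * `|x i| + e ^+ 2))).
  rewrite big_nat [leRHS]big_nat; apply: ler_sum => i /andP[_ im].
  have := ae i im; rewrite -[x i ^+ 2]real_normK ?num_real // => h.
  have : x i * a i <= `|x i| * `|a i| by rewrite -normrM ler_norm.
  have : (x i + a i) ^+ 2 = `|x i| ^+ 2 + 2 * (x i * a i) + `|a i| ^+ 2.
    by rewrite !real_normK ?num_real //; ring.
  have := normr_ge0 (x i); have := normr_ge0 (a i).
  move: `|x i| `|a i| h (x i * a i) => u b h t b0 u0 -> h2; nra.
rewrite !big_split /= -mulr_sumr sumr_const_nat subn0 -mulr_natl.
have := sum_norm_le_sqrt m x.
have := sqrtr_ge0 (m%:R : R); nra.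
Qed.

(** The window condition turns the linearized bound, with the deterministic
    [Y] in place of a random optimal parameter, into the self-normalized one.
    The hypothesis [y <= Num.sqrt m%:R] pays for the excess [4 p ell] by
    a part of the term [4 p y M]. *)
Lemma selfnormalized_bound (m : nat) (p y Y u Q S : R) :
  0 <= p -> 0 < y -> 0 < Y -> y <= Num.sqrt m%:R -> 
  (u + 2 * p * Num.sqrt m%:R - Y) ^+ 2 <= (21 / 10 + 4 * p) * (y * Y) ->
  Num.sqrt Q <= u + 2 * p * Num.sqrt m%:R -> 0 <= Q ->
  S <= y ^+ 2 / 2 / (y / Y) + (1 + 2 * p) * (y ^+ 2 / 2) + y / Y / 2 * Q ->
  S <= y * u + 4 * p * (y * Num.sqrt m%:R) + (31 / 10 + 2 * p) * (y ^+ 2 / 2).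
Proof.
move=> p0 y0 Y0; set M := Num.sqrt _ => yM; set Z := u + _ => hZ hQ Q0 hS.
have QZ : Q <= Z ^+ 2.
  by rewrite -(sqr_sqrtr Q0) ler_pXn2r ?nnegrE ?sqrtr_ge0 // (le_trans _ hQ).
apply: (le_trans hS).
have h1 : y / Y / 2 * Q <= y / Y / 2 * Z ^+ 2.
  by rewrite ler_wpM2l // !divr_ge0 // ltW.
have h2 : y ^+ 2 / 2 / (y / Y) + y / Y / 2 * Z ^+ 2 = y * Z + y / Y / 2 * (Z - Y) ^+ 2.
  by field; lra.
have h3 : y / Y / 2 * (Z - Y) ^+ 2 <= y / Y / 2 * ((21 / 10 + 4 * p) * (y * Y)).
  by rewrite ler_wpM2l // !divr_ge0 // ltW.
have h4 : y / Y / 2 * ((21 / 10 + 4 * p) * (y * Y)) = (21 / 10 + 4 * p) * (y ^+ 2 / 2).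
  by field; lra.
have h5 : p * (y * y) <= p * (y * M) by rewrite !ler_wpM2l // ltW.
have h6 : y * Z = y * u + 2 * (p * (y * M)) by rewrite /Z; ring.
nra.
Qed.
End sums.

(** * Self-normalized concentration of block sums *)

Section block_concentration.
Context (R : realType) (Om : finType) (C : eqType) (w : Om -> R).
Context (w_ge0 : forall x, 0 <= w x) (w_sum1 : \sum_x w x = 1).
Context (m : nat) (c : nat -> Om -> C).
Context (c_refine : forall j x y, c j.+1 x = c j.+1 y -> c j x = c j y).

Section bounded_sums.
Context (U r : nat -> Om -> R) (v : nat -> R) (rho : R).
Context (U_adapted : forall j, (j < m)%N -> adapted (c j.+1) (U j))
  (U01 : forall j x, (j < m)%N -> 0 <= U j x <= 1)
  (v_ge0 : forall j, (j < m)%N -> 0 <= v j)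
  (r_le : forall j x, (j <= m)%N -> `| r j x | <= rho)
  (r_start : forall x, r 0%N x = 0) (r_end : forall x, r m x = 0)
  (r_comp : forall j g, (j < m)%N -> adapted (c j) g ->
     mean w (fun x => g x * (U j x + r j.+1 x - r j x)) = v j * mean w g).
Let V := \sum_(0 <= i < m) v i.
Implicit Types (sg X : R).

(** Exponential Markov inequality for either tail, according to the sign of
    [s]. *)
Let chernoff (s a X : R) : - 1 <= s -> 2 * rho * s < 1 ->
  (forall u : R, 0 <= u <= 1 -> expR (a * u) <= 1 + s * u) ->
  mass w (fun x => s / (1 - 2 * rho * s) * V + X <=
    a * \sum_(0 <= i < m) U i x) <= expR (- X).
Proof.
move=> s1 rs as_le.
pose f x := expR (a * \sum_(0 <= i < m) U i x).
set t := s / _ * V.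
have f_le x : f x <= \prod_(0 <= i < m) (1 + s * U i x).
  rewrite /f mulr_sumr expR_sum big_nat [leRHS]big_nat.
  apply: ler_prod => i /andP[_ im]; rewrite expR_ge0 /= as_le //; exact: U01.
have rho0 : 0 <= rho.
  have [x _|x0] := pickP (@predT Om); first by apply: le_trans (r_le x (leqnn m)).
  by move: w_sum1; rewrite big_pred0 // => /eqP; rewrite eq_sym oner_eq0.
have := mass_ge_le_mean w_ge0 (expR_gt0 (t + X)) (fun x => expR_ge0 _ : 0 <= f x).
have := ler_mean w_ge0 f_le.
have := compensated_mgf w_ge0 w_sum1 c_refine U_adapted U01 v_ge0 r_le r_start
  r_end r_comp rho0 s1 rs.
rewrite -/t => h1 h2 h3.
apply: (@le_trans _ _ (mass w (fun x => expR (t + X) <= f x))).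
  by apply: mass_sub => // x; rewrite !unfold_in => h; rewrite ler_expR.
apply: (le_trans h3); rewrite ler_pdivrMr ?expR_gt0 // -expRD.
have -> : - X + (t + X) = t by ring.
exact: le_trans h1.
Qed.

Lemma bounded_sum_upper_tail sg X : 0 <= sg -> 2 * rho * sg < 1 ->
  mass w (fun x => sg / (1 - 2 * rho * sg) * V + X <=
    sg * (1 - sg / 2) * \sum_(0 <= i < m) U i x) <= expR (- X).
Proof.
move=> s0 rs; apply: chernoff => //; first by lra.
by move=> u u01; rewrite mulrC; exact: expR_le_1Dmul.
Qed.

Lemma bounded_sum_lower_tail sg X : 0 <= sg -> sg < 1 -> 0 <= rho ->
  mass w (fun x => sg * (1 - sg / 2) / (1 - sg) * \sum_(0 <= i < m) U i x <=
    sg / (1 + 2 * rho * sg) * V - X) <= expR (- X).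
Proof.
move=> s0 s1 rho0.
have h1 : - 1 <= - sg by lra.
have h2 : 2 * rho * - sg < 1 by have := mulr_ge0 rho0 s0; lra.
have h3 (u : R) : 0 <= u <= 1 ->
    expR (- (sg * (1 - sg / 2) / (1 - sg)) * u) <= 1 + - sg * u.
  by move=> u01; have := expR_le_1Bmul s0 s1 u01; rewrite !mulNr (mulrC u).
apply: le_trans (chernoff X h1 h2 h3).
apply: mass_sub => // x; rewrite !unfold_in mulrN opprK !mulNr; lra.
Qed.
End bounded_sums.

(** The functions [r1 j] and [r2 j] are to be the conditional means, given the
    first [j] blocks, of the later sums of [S i] and of [S i ^+ 2] minus its
    mean. *)
Context (S r1 r2 : nat -> Om -> R) (p : R).
Context (S_adapted : forall j, (j < m)%N -> adapted (c j.+1) (S j))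
  (S_le1 : forall j x, (j < m)%N -> `|S j x| <= 1)
  (p_ge0 : 0 <= p)
  (r1_adapted : forall j, (j <= m)%N -> adapted (c j) (r1 j))
  (r1_le : forall j x, (j <= m)%N -> `| r1 j x | <= p)
  (r1_start : forall x, r1 0%N x = 0) (r1_end : forall x, r1 m x = 0)
  (r1_comp : forall j g, (j < m)%N -> adapted (c j) g ->
     mean w (fun x => g x * (S j x + r1 j.+1 x - r1 j x)) = 0)
  (r2_le : forall j x, (j <= m)%N -> `| r2 j x | <= 1 + p)
  (r2_start : forall x, r2 0%N x = 0) (r2_end : forall x, r2 m x = 0)
  (r2_comp : forall j g, (j < m)%N -> adapted (c j) g ->
     mean w (fun x => g x * (S j x ^+ 2 + r2 j.+1 x - r2 j x)) =
       mean w (fun x => S j x ^+ 2) * mean w g).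

Let D j x : R := S j x + (r1 j.+1 x - r1 j x).
Let total x := \sum_(0 <= i < m) S i x.
Let U x := \sum_(0 <= i < m) S i x ^+ 2.
Let Q x := \sum_(0 <= i < m) D i x ^+ 2.

Let D_sum x : \sum_(0 <= i < m) D i x = total x.
Proof.
by rewrite /D big_split /= telescope_sumr // r1_start r1_end subrr addr0.
Qed.

Let D_corr j x : (j < m)%N -> `|r1 j.+1 x - r1 j x| <= 2 * p.
Proof.
move=> jm; apply: (le_trans (ler_normB _ _)).
by have := r1_le x jm; have := r1_le x (ltnW jm); lra.
Qed.

Let D_adapted j : (j < m)%N -> adapted (c j.+1) (D j).
Proof.
move=> jm x y e; rewrite /D (S_adapted jm e) (r1_adapted jm e).
by rewrite (r1_adapted (ltnW jm) (c_refine e)).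
Qed.

Let D_mgale j g : (j < m)%N -> adapted (c j) g ->
  mean w (fun x => g x * D j x) = 0.
Proof.
by move=> jm cg; rewrite -(r1_comp jm cg); apply: eq_mean => x; rewrite /D addrA.
Qed.

Let D_le j x : (j < m)%N -> `|D j x| <= 1 + 2 * p.
Proof.
move=> jm; apply: (le_trans (ler_normD _ _)).
by have := S_le1 x jm; have := D_corr x jm; lra.
Qed.

(** The tail bound at [lam = b / (1 + (1 + 2 p) b)], which removes the
    denominator [1 - lam * (1 + 2 p)] and leaves the free parameter [b]. *)
Lemma martingale_two_sided_tail (ell b : R) : 0 < b ->
  mass w (fun x => ell / b + (1 + 2 * p) * ell + b / 2 * Q x < `|total x|)
    <= 2 * expR (- ell).
Proof.
move=> b0; have k0 : 0 < 1 + 2 * p by rewrite ltr_pwDl ?mulr_ge0.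
have D_le' := D_le; move: (1 + 2 * p) k0 D_le' => k k0 D_le'.
pose lam := b / (1 + k * b).
have kb : 0 < 1 + k * b by rewrite addr_gt0 ?mulr_gt0.
have lam0 : 0 < lam by rewrite divr_gt0.
have lamk : lam * k < 1 by rewrite /lam mulrAC ltr_pdivrMr // mul1r (mulrC b) ltrDr.
have e1 : ell / lam = ell / b + k * ell by rewrite /lam; field; lra.
have e2 : lam / (2 * (1 - lam * k)) = b / 2.
  by rewrite /lam; field; rewrite ?gt_eqF //=; lra.
have Dn j g : (j < m)%N -> adapted (c j) g ->
    mean w (fun x => g x * - D j x) = 0.
  move=> jm cg; rewrite (@eq_mean _ _ _ _ (fun x => - 1 * (g x * D j x))).
    by rewrite meanZ D_mgale // mulr0.
  by move=> x; ring.
have tp : mass w (fun x => ell / b + k * ell + b / 2 * Q x < total x)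
    <= expR (- ell).
  have h := @selfnormalized_tail R Om C w w_ge0 w_sum1 m c c_refine D k lam ell
    D_adapted D_mgale _ lam0 (ltW k0) lamk.
  apply: le_trans (h _) => [|j x jm]; last first.
    by have := D_le' j x jm; rewrite ler_norml => /andP[].
  by apply: mass_sub => // x; rewrite !unfold_in e1 e2 D_sum.
have tn : mass w (fun x => ell / b + k * ell + b / 2 * Q x < - total x)
    <= expR (- ell).
  have h := @selfnormalized_tail R Om C w w_ge0 w_sum1 m c c_refine
    (fun j x => - D j x) k lam ell _ Dn _ lam0 (ltW k0) lamk.
  apply: le_trans (h _ _) => [|j jm x y e|j x jm]; last first.
  - by have := D_le' j x jm; rewrite ler_norml lerN2 => /andP[].
  - by rewrite (D_adapted jm e).
  apply: mass_sub => // x; rewrite !unfold_in e1 e2 sumrN D_sum.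
  by rewrite (eq_bigr (fun i => D i x ^+ 2)) // => i _; rewrite sqrrN.
rewrite mulr_natl mulr2n; apply: le_trans (lerD tp tn).
apply: le_trans (mass_setU w_ge0 _ _).
apply: mass_sub => // x; rewrite !unfold_in /= lter_normr.
by move=> /orP[->|->] //; rewrite orbT.
Qed.

Let U01 j x : (j < m)%N -> 0 <= S j x ^+ 2 <= 1.
Proof.
move=> jm; rewrite sqr_ge0 /= -real_normK ?num_real //.
by rewrite expr_le1 // S_le1.
Qed.

Let V := \sum_(0 <= i < m) mean w (fun x => S i x ^+ 2).

Let v_ge0 j : (j < m)%N -> 0 <= mean w (fun x => S j x ^+ 2).
Proof. by move=> _; apply: mean_ge0 => // x; exact: sqr_ge0. Qed.

Let S2_adapted j : (j < m)%N -> adapted (c j.+1) (fun x => S j x ^+ 2).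
Proof. by move=> jm x y e; rewrite (S_adapted jm e). Qed.

Let U_ge0 x : 0 <= U x.
Proof. by apply: sumr_ge0 => i _; exact: sqr_ge0. Qed.

(** Outside an event of probability [delta = expR (- (y ^+ 2 / 2))], the random
    quantity [sqrt U + 2 p M] stays in a window around a deterministic [Y].  If the mean
    [V] of [U] is of order [ell], an upper tail of level [delta] is enough;
    otherwise both tails are taken at level [delta / 2], which is the meaning
    of the third hypothesis. *)
Lemma quadratic_sum_localized (y : R) : 0 < y -> p <= 1 / 2 ->
  2 * expR (- (5 / 6 * y ^+ 2)) <= expR (- (y ^+ 2 / 2)) ->
  exists2 Y, 0 < Y &
    mass w (fun x => (21 / 10 + 4 * p) * (y * Y) <
       (Num.sqrt (U x) + 2 * p * Num.sqrt m%:R - Y) ^+ 2)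
    <= expR (- (y ^+ 2 / 2)).
Proof.
move=> y0 p12 y2; have p0 := p_ge0.
set M := Num.sqrt _; have M0 : 0 <= M by exact: sqrtr_ge0.
have q0 : 0 < 21 / 10 + 4 * p by rewrite ltr_pwDl ?mulr_ge0.
have pM : 0 <= 2 * p * M by rewrite !mulr_ge0.
have V0 : 0 <= V by rewrite /V big_nat; apply: sumr_ge0 => i /andP[_ /v_ge0].
have [Vs|Vl] := leP V ((3 + 2 * p) ^+ 2 * y ^+ 2).
  exists (2 * p * M + (21 / 10 + 4 * p) * y).
    by rewrite ltr_wpDl // mulr_gt0.
  have rs : 2 * (1 + p) * (1 / 10) < 1 by lra.
  apply: le_trans (bounded_sum_upper_tail S2_adapted U01 v_ge0 r2_le r2_start
    r2_end r2_comp (y ^+ 2 / 2) _ rs); last by [].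
  apply: mass_sub => // x; rewrite !unfold_in -/V -/(U x); apply: contraTT.
  rewrite -ltNge -leNgt => h.
  have := fluctuation_small_variance p_ge0 p12 Vs h => hU.
  have : Num.sqrt (U x) <= 2 * (21 / 10 + 4 * p) * y.
    rewrite -(ger0_norm (mulr_ge0 (mulr_ge0 (ler0n _ 2) (ltW q0)) (ltW y0))).
    by rewrite -sqrtr_sqr ler_wsqrtr.
  have := sqrtr_ge0 (U x); move: (Num.sqrt (U x)) => u u0 u1.
  have -> : u + 2 * p * M - (2 * p * M + (21 / 10 + 4 * p) * y) =
    u - (21 / 10 + 4 * p) * y by ring.
  apply: (@le_trans _ _ ((21 / 10 + 4 * p) * (y * ((21 / 10 + 4 * p) * y)))).
    by move: (21 / 10 + 4 * p) q0 u1 => q q0 u1; nra.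
  by rewrite !ler_wpM2l ?(ltW q0) ?(ltW y0) // lerDr.
have [v [v0 vE]] : exists v : R, 3 + 2 * p < v /\ V = (v * y) ^+ 2.
  exists (Num.sqrt V / y); split; last by rewrite divfK ?gt_eqF // sqr_sqrtr.
  rewrite ltr_pdivlMr //.
  have h : 0 <= (3 + 2 * p) * y by rewrite mulr_ge0 ?(ltW y0) // addr_ge0 ?mulr_ge0.
  rewrite -(ger0_norm h) -sqrtr_sqr ltr_sqrt ?exprMn //.
  by apply: le_lt_trans Vl; rewrite mulr_ge0 ?sqr_ge0.
have v3 : 3 < v by apply: le_lt_trans v0; rewrite lerDl mulr_ge0.
have vp : 0 < v by apply: lt_trans v3.
exists (2 * p * M + v * y); first by rewrite ltr_wpDl // mulr_gt0.
pose al := 1444 / 1000 + 58 / 100 * p.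
have al0 : 1 <= al by rewrite /al; lra.
pose s1 := (7 / 2 + 2 * v)^-1; pose s2 := 5 / 6 / (al * v).
have s10 : 0 <= s1 by rewrite invr_ge0; lra.
have s1r : 2 * (3 / 2) * s1 < 1.
  by rewrite /s1 ltr_pdivrMr; lra.
have alv : 3 < al * v by nra.
have s20 : 0 <= s2 by rewrite divr_ge0 //; lra.
have s21 : s2 < 1 by rewrite /s2 ltr_pdivrMr; lra.
have p1 : 0 <= 1 + p by rewrite addr_ge0.
have r2_le' j x : (j <= m)%N -> `|r2 j x| <= 3 / 2.
  by move=> jm; apply: le_trans (r2_le x jm) _; lra.
have up := bounded_sum_upper_tail S2_adapted U01 v_ge0 r2_le' r2_start
    r2_end r2_comp (5 / 6 * y ^+ 2) s10 s1r.
have lo := bounded_sum_lower_tail S2_adapted U01 v_ge0 r2_le r2_start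
    r2_end r2_comp (5 / 6 * y ^+ 2) s20 s21 p1.
apply: le_trans y2; apply: (@le_trans _ _ (expR (- (5 / 6 * y ^+ 2)) + expR (- (5 / 6 * y ^+ 2)))); last first.
  by rewrite [leRHS]mulr_natl mulr2n.
apply: le_trans (lerD up lo).
apply: le_trans (mass_setU w_ge0 _ _).
apply: mass_sub => // x; rewrite !unfold_in /= -/V -/(U x) vE.
apply: contraTT; rewrite negb_or -!ltNge -leNgt => /andP[h1 h2].
have := fluctuation_upper (ltW v3) y0 h1.
have := fluctuation_lower p_ge0 p12 (ltW v0) y0 h2.
rewrite -/al -{1 2}(sqr_sqrtr (U_ge0 x)).
move: (Num.sqrt (U x)) (sqrtr_ge0 (U x)) => u u0 {lo up} lo up.
have -> : u + 2 * p * M - (2 * p * M + v * y) = u - v * y by ring.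
apply: (@le_trans _ _ ((21 / 10 + 4 * p) * (v * y ^+ 2))); last first.
  rewrite ler_wpM2l ?(ltW q0) // [leRHS]mulrDr.
  have -> : v * y ^+ 2 = y * (v * y) by ring.
  by rewrite lerDr mulr_ge0 // ltW.
have [t tE] : exists t : R, u = t * y.
  by exists (u / y); rewrite divfK ?gt_eqF.
have t0 : 0 <= t by move: u0; rewrite tE pmulr_lge0.
have y20 : 0 < y ^+ 2 by rewrite exprn_gt0.
move: lo up; rewrite tE !exprMn !ler_pM2r // => lo up.
have tv : t <= v + 5 / 2.
  by rewrite -(ler_pXn2r (n := 2)) ?nnegrE //; lra.
rewrite -[t * y - _]mulrBl exprMn [leRHS]mulrA ler_pM2r //.
exact: (fluctuation_window p_ge0 (ltW v0) t0 tv lo).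
Qed.

(** For [p > 1/2] the quadratic variation is bounded by its largest possible
    value, which gives the radius [(1 + 2 p) (y M + ell)], and
    [1 + 2 p <= 4 p].  For [p <= 1/2] the three exceptional events are the two tails of
    the martingale and the delocalization of [U]. *)
Theorem block_sum_concentration (delta : R) : 0 < delta -> delta < 1 / 3 ->
  2 * ln delta^-1 < m%:R ->
  mass w (fun x =>
    Num.sqrt (2 * ln delta^-1) * Num.sqrt (\sum_(0 <= i < m) S i x ^+ 2)
    + 4 * p * (Num.sqrt (2 * ln delta^-1) * Num.sqrt m%:R)
    + (31 / 10 + 2 * p) * ln delta^-1 < `|\sum_(0 <= i < m) S i x|)
  <= 3 * delta.
Proof.
move=> d0 d3 hm; have p0 := p_ge0.
set ell := ln delta^-1 in hm *; set y := Num.sqrt (2 * ell).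
have ell0 : 0 < ell.
  by rewrite /ell ln_gt0 // invf_gt1 //; apply: lt_trans d3 _; lra.
have elld : expR (- ell) = delta by rewrite /ell lnV ?posrE // opprK lnK.
have y0 : 0 < y by rewrite sqrtr_gt0 mulr_gt0.
have y2 : y ^+ 2 / 2 = ell by rewrite sqr_sqrtr ?mulr_ge0 ?(ltW ell0) //; field.
have yM : y <= Num.sqrt m%:R by rewrite ler_wsqrtr // ltW.
have M0 : 0 < Num.sqrt m%:R :> R by apply: lt_le_trans yM.
have bound Y x : 0 < Y ->
  (Num.sqrt (U x) + 2 * p * Num.sqrt m%:R - Y) ^+ 2
     <= (21 / 10 + 4 * p) * (y * Y) ->
  `|total x| <= ell / (y / Y) + (1 + 2 * p) * ell + y / Y / 2 * Q x ->
  `|total x| <= y * Num.sqrt (U x) + 4 * p * (y * Num.sqrt m%:R) + (31 / 10 + 2 * p) * ell.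
  move=> Y0 hY; rewrite -y2; apply: (selfnormalized_bound p0 y0 Y0 yM hY).
    apply: sqrt_sum_sqr_shift => [|i im]; first by rewrite mulr_ge0.
    exact: D_corr.
  by apply: sumr_ge0 => i _; exact: sqr_ge0.
have [p12|p12] := leP p (1 / 2).
  have h : 2 * expR (- (5 / 6 * y ^+ 2)) <= expR (- (y ^+ 2 / 2)).
    have -> : 5 / 6 * y ^+ 2 = 5 / 3 * ell by rewrite -y2; field.
    rewrite y2 -ler_pdivlMr ?expR_gt0 // -expRN -expRD opprK.
    (* exp (2/3 ell) >= 2 because its cube is delta^-2 > 9 *)
    rewrite -(ler_pXn2r (n := 3)) ?nnegrE ?expR_ge0 // -expRM_natl.
    have -> : 3 * (- ell + 5 / 3 * ell) = 2 * ell by field.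
    rewrite expRM_natl /ell lnK ?posrE ?invr_gt0 //.
    have d1 : 3 < delta^-1 by rewrite -[ltLHS]invrK ltf_pV2 ?posrE //; lra.
    by have d2 : delta^-1 ^+ 2 = delta^-1 * delta^-1 by []; nra.
  have [Y Y0 hQ] := quadratic_sum_localized y0 p12 h.
  have hT := martingale_two_sided_tail ell (divr_gt0 y0 Y0).
  have -> : 3 * delta = delta + 2 * delta by ring.
  rewrite y2 elld in hQ; rewrite elld in hT.
  apply: le_trans (lerD hQ hT); apply: le_trans (mass_setU w_ge0 _ _).
  apply: mass_sub => // x; rewrite !unfold_in /= -/(U x) -/(total x).
  by apply: contraTT; rewrite negb_or -!leNgt => /andP[]; exact: bound.
pose Y := (1 + 2 * p) * Num.sqrt m%:R.
have Y0 : 0 < Y by rewrite mulr_gt0 //; lra.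
have hT := martingale_two_sided_tail ell (divr_gt0 y0 Y0).
rewrite elld in hT; apply: (@le_trans _ _ (2 * delta)); last by rewrite ler_pM2r //; lra.
apply: le_trans hT; apply: mass_sub => // x; rewrite !unfold_in -/(U x) -/(total x).
apply: le_lt_trans.
have QY : Q x <= Y ^+ 2.
  rewrite /Y exprMn sqr_sqrtr ?ler0n //.
  have -> : (1 + 2 * p) ^+ 2 * m%:R = \sum_(0 <= i < m) (1 + 2 * p) ^+ 2.
    by rewrite sumr_const_nat subn0 mulr_natr.
  rewrite /Q big_nat [leRHS]big_nat; apply: ler_sum => i /andP[_ im].
  have := D_le x im; rewrite -[D i x ^+ 2]real_normK ?num_real // => h.
  by rewrite ler_pXn2r ?nnegrE //; lra.
have h1 : y / Y / 2 * Q x <= y / Y / 2 * Y ^+ 2.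
  by rewrite ler_wpM2l // !divr_ge0 // ltW.
have h2 : ell / (y / Y) + y / Y / 2 * Y ^+ 2 = y * Y.
  by rewrite -y2; field; rewrite !gt_eqF.
have h3 : 0 <= y * Num.sqrt (U x) by rewrite mulr_ge0 ?sqrtr_ge0 // ltW.
have h4 : y * Y <= 4 * p * (y * Num.sqrt m%:R).
  rewrite /Y; have -> : y * ((1 + 2 * p) * Num.sqrt m%:R) = (1 + 2 * p) * (y * Num.sqrt m%:R) by ring.
  by rewrite ler_wpM2r ?mulr_ge0 ?sqrtr_ge0 ?ltW //; lra.
have h5 : (1 + 2 * p) * ell <= (31 / 10 + 2 * p) * ell by rewrite ler_pM2r //; lra.
lra.
Qed.
End block_concentration.

(** * Consequences of phi-mixing on a finite space *)

Section finite_mixing.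
Context (R : realType) (Om : finType) (C : eqType) (w : Om -> R).
Context (w_ge0 : forall x, 0 <= w x) (w_sum1 : \sum_x w x = 1).
Implicit Types (f : Om -> R) (c s : Om -> C) (A B : pred Om).

(** The density of the signed measure [B |-> mass (A and B) - mass A * mass B]
    with respect to counting. *)
Let signed_mass A x : R := w x * ((A x)%:R - mass w A).

Let sum_signed_mass A B : \sum_(x | B x) signed_mass A x =
  mass w (predI A B) - mass w A * mass w B.
Proof.
rewrite /signed_mass; under eq_bigr do rewrite mulrBr.
rewrite sumrB -mulr_suml mulrC; congr (_ - _).
rewrite /mass (bigID A) /= [X in _ + X]big1 => [|x /andP[_ /negbTE ->]].
  rewrite addr0; apply: eq_big => [x|x /andP[_ ->]]; rewrite ?mulr1 //.
  by rewrite andbC.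
by rewrite mulr0.
Qed.

(** The integral is largest when [f] equals [W] on the [s]-measurable set [B]
    where the signed measure is positive (Hahn decomposition) and 0
    elsewhere. *)
Let signed_mass_le A s e W f : adapted s f ->
  (forall B, adapted s B -> mass w (predI A B) - mass w A * mass w B <= e) ->
  0 <= W -> (forall x, 0 <= f x <= W) ->
  \sum_x signed_mass A x * f x <= e * W.
Proof.
move=> sf mixA W0 f0W.
(* a finite set of labels for the level sets of s *)
pose rep x := [pick y | s y == s x].
have repE x y : rep x = rep y -> s x = s y.
  rewrite /rep; case: pickP => [z /eqP <-|/(_ x)]; last by rewrite eqxx.
  by case: pickP => [t /eqP tE [->]//|//].
have repE' x y : s x = s y -> rep x = rep y.
  by move=> e'; rewrite /rep; apply: eq_pick => z; rewrite e'.
pose q j := \sum_(x | rep x == j) signed_mass A x.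
pose B x := 0 < q (rep x).
have sB : adapted s B by move=> x y /repE'; rewrite /B => ->.
apply: (@le_trans _ _ ((\sum_(x | B x) signed_mass A x) * W)); last first.
  by rewrite ler_wpM2r // sum_signed_mass mixA.
rewrite (partition_big rep predT) //= [X in _ <= X * _](partition_big rep predT) //=.
rewrite mulr_suml; apply: ler_sum => j _.
have [x0 /eqP x0j|none] := pickP (fun x => rep x == j); last first.
  by rewrite !big_pred0 ?mul0r // => x; rewrite none ?andbF.
have -> : \sum_(x | rep x == j) signed_mass A x * f x = q j * f x0.
  rewrite mulr_suml; apply: eq_bigr => x /eqP xj; congr (_ * _).
  by apply/sf/repE; rewrite xj.
have /andP[f0 fW] := f0W x0.
have [qj|qj] := ltP 0 (q j).
  rewrite (eq_bigl (fun x => rep x == j)) => [|x]; first by rewrite ler_wpM2l // ltW.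
  by case: eqVneq => [e'|]; rewrite ?andbF ?andbT // /B e' qj.
rewrite big_pred0 => [|x]; first by rewrite mul0r mulr_le0_ge0.
by case: eqVneq => [e'|]; rewrite ?andbF ?andbT // /B e' ltNge qj.
Qed.

Lemma mixing_covariance A s e lo W f : adapted s f ->
  (forall B, adapted s B ->
     `| mass w (predI A B) - mass w A * mass w B | <= e) ->
  0 <= W -> (forall x, lo <= f x <= lo + W) ->
  `| \sum_(x | A x) w x * f x - mass w A * mean w f | <= e * W.
Proof.
move=> sf mixA W0 fW.
have sm0 : \sum_x signed_mass A x = 0.
  rewrite (sum_signed_mass A predT).
  have -> : mass w predT = 1 by rewrite -w_sum1 /mass.
  rewrite mulr1 (_ : mass w (predI A predT) = mass w A) ?subrr //.
  by apply: eq_bigl => x /=; rewrite andbT.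
have -> : \sum_(x | A x) w x * f x - mass w A * mean w f =
    \sum_x signed_mass A x * (f x - lo).
  under [RHS]eq_bigr do rewrite mulrBr.
  rewrite sumrB -mulr_suml sm0 mul0r subr0 /mean mulr_sumr big_mkcond /= -sumrB.
  apply: eq_bigr => x _; rewrite /signed_mass; case: (A x) => /=; ring.
have mixA' B : adapted s B -> mass w (predI A B) - mass w A * mass w B <= e.
  by move=> /mixA; apply: le_trans; rewrite ler_norm.
rewrite ler_norml; apply/andP; split.
  rewrite -[leRHS]opprK lerN2 -sumrN.
  have -> : \sum_x - (signed_mass A x * (f x - lo)) =
      \sum_x signed_mass A x * (lo + W - f x).
    apply/eqP; rewrite -subr_eq0 -sumrB.
    have -> : \sum_x (- (signed_mass A x * (f x - lo))
        - signed_mass A x * (lo + W - f x)) = \sum_x signed_mass A x * (- W).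
      by apply: eq_bigr => x _; ring.
    by rewrite -mulr_suml sm0 mul0r.
  apply: signed_mass_le mixA' W0 _ => [x y /sf -> //|x].
  by have := fW x; move=> /andP[? ?]; apply/andP; split; lra.
apply: signed_mass_le mixA' W0 _ => [x y /sf -> //|x].
by have := fW x; move=> /andP[? ?]; apply/andP; split; lra.
Qed.

Lemma cond_mean_centered_le c s g lo W f :
  adapted s f ->
  (forall A B, adapted c A -> adapted s B ->
     `| mass w (predI A B) - mass w A * mass w B | <= g * mass w A) ->
  0 <= g -> 0 <= W -> (forall x, lo <= f x <= lo + W) ->
  forall x, `| cond_mean w c (fun y => f y - mean w f) x | <= g * W.
Proof.
move=> sf mixc g0 W0 fW x; pose A := fun y => c y == c x.
have cA : adapted c A by move=> y z e; rewrite /A e.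
rewrite /cond_mean -/A.
under eq_bigr do rewrite mulrBr.
rewrite sumrB -mulr_suml -/(mass w A).
have [->|mA] := eqVneq (mass w A) 0.
  by rewrite invr0 mulr0 normr0 mulr_ge0.
have mA0 : 0 < mass w A by rewrite lt_neqAle eq_sym mA mass_ge0.
rewrite normrM normfV (ger0_norm (ltW mA0)) ler_pdivrMr //.
rewrite mulrAC; apply: mixing_covariance sf _ W0 fW => B sB; exact: mixc.
Qed.

Lemma cond_mean_sum c (F : nat -> Om -> R) i j x :
  cond_mean w c (fun y => \sum_(i <= k < j) F k y) x =
  \sum_(i <= k < j) cond_mean w c (F k) x.
Proof.
rewrite /cond_mean -mulr_suml exchange_big /=; congr (_ * _).
by apply: eq_bigr => y _; rewrite mulr_sumr.
Qed.

End finite_mixing.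

(** * Sums over blocks *)

Lemma sum_nat_blocks (R : realType) (F : nat -> R) (L i j : nat) : (i <= j)%N ->
  \sum_(i <= k < j) \sum_(k * L <= t < k.+1 * L) F t =
  \sum_(i * L <= t < j * L) F t.
Proof.
elim: j => [|j IH]; first by rewrite leqn0 => /eqP ->; rewrite !big_geq.
rewrite leq_eqVlt => /orP[/eqP -> |]; first by rewrite !big_geq.
rewrite ltnS => ij; rewrite big_nat_recr //= IH //.
rewrite [RHS](big_cat_nat _ (n := (j * L)%N)) //= leq_mul2r ?ij ?leqnSn ?orbT //.
Qed.

(** By monotonicity each sampled value after the first is at most the average
    of the [L] preceding ones. *)
Lemma sum_sampled_nonincreasing (R : realType) (phi : nat -> R) (L n : nat) :
  (0 < L)%N -> (forall i j, (i <= j)%N -> phi j.+1 <= phi i.+1) ->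
  phi 1%N <= 1 ->
  L%:R * \sum_(0 <= i < n.+1) phi (i * L).+1 <=
    L%:R + \sum_(0 <= k < n * L) phi k.+1.
Proof.
move=> L0 dec phi1; elim: n => [|n IH].
  by rewrite big_nat1 mul0n big_geq // addr0 ler_piMr.
rewrite big_nat_recr //= mulrDr.
rewrite [X in _ <= _ + X](big_cat_nat _ (n := (n * L)%N)) //=; last first.
  by rewrite leq_mul2r leqnSn orbT.
rewrite addrA; apply: lerD => //.
have -> : L%:R * phi (n.+1 * L).+1 =
    \sum_(n * L <= k < n.+1 * L) phi (n.+1 * L).+1.
  by rewrite sumr_const_nat mulSn addnK mulr_natl.
apply: ler_sum_nat => k /andP[_ kn].
exact/dec/ltnW.
Qed.

(** * Block sums of a mixing sequence of letters *)

Section words.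
Context (R : realType) (Om : finType) (A : eqType) (w : Om -> R).
Context (w_ge0 : forall x, 0 <= w x) (w_sum1 : \sum_x w x = 1).
Context (X : nat -> Om -> A) (N : nat).

Definition past k x : seq A := [seq X i x | i <- iota 0 k].
Definition future k x : seq A := [seq X i x | i <- iota k (N - k)].

Lemma pastP k x y :
  past k x = past k y <-> forall i, (i < k)%N -> X i x = X i y.
Proof.
split=> [/eq_in_map h i ik|h]; first by apply: h; rewrite mem_iota.
by apply/eq_in_map => i; rewrite mem_iota => /andP[_]; exact: h.
Qed.

Lemma futureP k x y : future k x = future k y <->
  forall i, (k <= i)%N -> (i < N)%N -> X i x = X i y.
Proof.
split=> [/eq_in_map h i ki iN|h].
  by apply: h; rewrite mem_iota ki /= subnKC // (leq_trans ki) // ltnW.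
apply/eq_in_map => i; rewrite mem_iota => /andP[ki]; have [kN|Nk] := leqP k N.
  by rewrite subnKC //; exact: h.
move: Nk => /ltnW; rewrite -subn_eq0 => /eqP ->; rewrite addn0 => /(leq_ltn_trans ki).
by rewrite ltnn.
Qed.

Context (phi : nat -> R) (m L : nat) (val : nat -> Om -> R) (lo : R).
Context (NE : N = (m * L)%N) (L_gt0 : (0 < L)%N)
  (phi_ge0 : forall k, 0 <= phi k) (phi_le1 : phi 1%N <= 1)
  (phi_nonincr : forall i j, (i <= j)%N -> phi j.+1 <= phi i.+1)
  (mixing : forall k s (A B : pred Om), (k <= s)%N ->
     adapted (past k) A -> adapted (future s) B ->
     `| mass w (predI A B) - mass w A * mass w B | <= phi (s - k).+1 * mass w A)
  (val_adapted : forall t x y, X t x = X t y -> val t x = val t y)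
  (val_range : forall t x, lo <= val t x <= lo + L%:R^-1).

Let c j := past (j * L).
Let centered t x := val t x - mean w (val t).
Let S i x := \sum_(i * L <= t < i.+1 * L) centered t x.
Let p := (\sum_(0 <= k < N) phi k.+1) / L%:R.

Let L0 : 0 < L%:R :> R. Proof. by rewrite ltr0n. Qed.

Let mean_range t : lo <= mean w (val t) <= lo + L%:R^-1.
Proof.
have mc a := mean_cst a w_sum1.
by rewrite -{1}(mc lo) -(mc (lo + _)) !ler_mean // => x; have /andP[] := val_range t x.
Qed.

Let c_refine j x y : c j.+1 x = c j.+1 y -> c j x = c j y.
Proof.
move=> /pastP h; apply/pastP => i ij; apply: h; apply: leq_trans ij _.
by rewrite leq_mul2r leqnSn orbT.
Qed.

Let S_adapted j : (j < m)%N -> adapted (c j.+1) (S j).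
Proof.
move=> jm x y /pastP h; apply: eq_big_nat => t /andP[_ tj].
by rewrite /centered (val_adapted (h t tj)).
Qed.

Let S_future j : (j < m)%N -> adapted (future (j * L)) (S j).
Proof.
move=> jm x y /futureP h; apply: eq_big_nat => t /andP[jt tj].
rewrite /centered (val_adapted (h t jt _)) // NE (leq_trans tj) //.
by rewrite leq_mul2r jm orbT.
Qed.

Let S_le1 j x : `|S j x| <= 1.
Proof.
apply: (le_trans (ler_norm_sum _ _ _)).
have -> : 1 = \sum_(j * L <= t < j.+1 * L) L%:R^-1 :> R.
  by rewrite sumr_const_nat mulSn addnK -[RHS]mulr_natl mulfV // gt_eqF.
apply: ler_sum => t _; rewrite /centered ler_norml.
have /andP[h1 h2] := val_range t x; have /andP[h3 h4] := mean_range t.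
by apply/andP; split; lra.
Qed.

Let r1 j := cond_mean w (c j) (fun x => \sum_(j <= i < m) S i x).
Let v i := mean w (fun x => S i x ^+ 2).
Let r2 j := cond_mean w (c j) (fun x => \sum_(j <= i < m) (S i x ^+ 2 - v i)).

Let cond_mean0 j f : (forall x, f x = 0) -> forall x, cond_mean w (c j) f x = 0.
Proof. by move=> f0 x; rewrite /cond_mean big1 ?mul0r // => y _; rewrite f0 mulr0. Qed.

Let cond_mean_start f : mean w f = 0 -> forall x, cond_mean w (c 0) f x = 0.
Proof.
move=> f0 x; rewrite /cond_mean (eq_bigl predT) => [|y]; last first.
  by rewrite /c /past mul0n /= eqxx.
by rewrite -[X in X / _]/(mean w f) f0 mul0r.
Qed.

Let mean_center f : mean w (fun x => f x - mean w f) = 0.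
Proof. by rewrite meanD mean_cst // subrr. Qed.

Let p_ge0 : 0 <= p.
Proof. by rewrite divr_ge0 ?ler0n // sumr_ge0. Qed.

(** The coefficients at distances 1, 2, ... from the last observed letter add
    up to [L * p]; each letter contributes a range [L^-1]. *)
Let r1_le j x : (j <= m)%N -> `|r1 j x| <= p.
Proof.
move=> jm; rewrite /r1.
have -> : cond_mean w (c j) (fun x => \sum_(j <= i < m) S i x) x =
    \sum_(j * L <= t < N) cond_mean w (c j) (centered t) x.
  rewrite -cond_mean_sum NE /S; congr (cond_mean _ _ _ _); apply/funext => y.
  exact: sum_nat_blocks.
apply: (le_trans (ler_norm_sum _ _ _)).
apply: (@le_trans _ _ (\sum_(j * L <= t < N) phi (t - j * L).+1 * L%:R^-1)).
  apply: ler_sum_nat => t /andP[jt tN].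
  apply: (@cond_mean_centered_le R Om (seq A) w w_ge0 w_sum1 (c j) (future t)
    (phi (t - j * L).+1) lo) => //.
  - by move=> y z /futureP h; apply/val_adapted/h.
  - by move=> B1 B2; exact: mixing.
rewrite -mulr_suml /p ler_pM2r ?invr_gt0 // -{1}[(j * L)%N]add0n big_addn.
under eq_bigr do rewrite addnK.
rewrite [leRHS](big_cat_nat _ (n := (N - j * L)%N)) ?leq_subr //= lerDl.
exact: sumr_ge0.
Qed.

(** The next block may depend arbitrarily on the past, and accounts for the
    term 1; the blocks after it are at distances [L + 1], [2 L + 1], ... *)
Let r2_le j x : (j <= m)%N -> `|r2 j x| <= 1 + p.
Proof.
move=> jm; rewrite /r2 cond_mean_sum.
apply: (le_trans (ler_norm_sum _ _ _)).
apply: (@le_trans _ _ (\sum_(j <= i < m) phi ((i - j) * L).+1)).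
  apply: ler_sum_nat => i /andP[ji im]; rewrite -[leRHS]mulr1.
  apply: (@cond_mean_centered_le R Om (seq A) w w_ge0 w_sum1 (c j)
    (future (i * L)) (phi ((i - j) * L).+1) 0) => //.
  - by move=> y z h; rewrite (S_future im h).
  - by move=> B1 B2; rewrite mulnBl; apply: mixing; rewrite leq_mul2r ji orbT.
  - move=> y; rewrite sqr_ge0 add0r -real_normK ?num_real //=.
    by rewrite expr_le1.
rewrite -{1}[j]add0n big_addn; under eq_bigr do rewrite addnK.
case: (m - j)%N (leq_subr j m) => [|n] nm.
  by rewrite big_geq // addr_ge0.
rewrite -(ler_pM2l L0) mulrDr mulr1 /p [L%:R * (_ / _)]mulrC divfK ?gt_eqF //.
apply: le_trans (sum_sampled_nonincreasing n L_gt0 phi_nonincr phi_le1) _.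
rewrite lerD2l [leRHS](big_cat_nat _ (n := (n * L)%N)) //= ?lerDl ?sumr_ge0 //.
by rewrite NE leq_mul2r (ltnW nm) orbT.
Qed.

Let r1_start x : r1 0 x = 0.
Proof.
apply: cond_mean_start; rewrite mean_sum big1_seq // => i _.
by rewrite mean_sum big1_seq // => t _; exact: mean_center.
Qed.

Let r2_start x : r2 0 x = 0.
Proof.
by apply: cond_mean_start; rewrite mean_sum big1_seq // => i _; exact: mean_center.
Qed.

Let adapted_next j (g : Om -> R) : adapted (c j) g -> adapted (c j.+1) g.
Proof. by move=> cg x y /c_refine /cg. Qed.

Let r1_comp j (g : Om -> R) : (j < m)%N -> adapted (c j) g ->
  mean w (fun x => g x * (S j x + r1 j.+1 x - r1 j x)) = 0.
Proof.
move=> jm cg.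
rewrite (@eq_mean _ _ _ _ (fun x => (g x * S j x + g x * r1 j.+1 x)
   + - 1 * (g x * r1 j x))); last by move=> x; ring.
rewrite meanD meanD meanZ !mean_cond_mean //; last exact: adapted_next.
rewrite -meanZ -!meanD -[RHS](mean_cst 0 w_sum1); apply: eq_mean => x.
by rewrite (big_ltn jm); ring.
Qed.

Let r2_comp j (g : Om -> R) : (j < m)%N -> adapted (c j) g ->
  mean w (fun x => g x * (S j x ^+ 2 + r2 j.+1 x - r2 j x)) = v j * mean w g.
Proof.
move=> jm cg.
rewrite (@eq_mean _ _ _ _ (fun x => (g x * S j x ^+ 2 + g x * r2 j.+1 x)
   + - 1 * (g x * r2 j x))); last by move=> x; ring.
rewrite meanD meanD meanZ !mean_cond_mean //; last exact: adapted_next.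
rewrite -!meanZ -!meanD; apply: eq_mean => x.
by rewrite (big_ltn jm); ring.
Qed.

Theorem mixing_block_concentration (delta : R) : 0 < delta -> delta < 1 / 3 ->
  2 * ln delta^-1 < m%:R ->
  mass w (fun x =>
    Num.sqrt (2 * ln delta^-1) * Num.sqrt (\sum_(0 <= i < m) S i x ^+ 2)
    + 4 * p * (Num.sqrt (2 * ln delta^-1) * Num.sqrt m%:R)
    + (31 / 10 + 2 * p) * ln delta^-1 < `|\sum_(0 <= i < m) S i x|)
  <= 3 * delta.
Proof.
apply: (@block_sum_concentration R Om (seq A) w w_ge0 w_sum1 m c c_refine S r1 r2 p
  S_adapted _ p_ge0 _ r1_le r1_start _ r1_comp r2_le r2_start _ r2_comp).
- by move=> j x _; exact: S_le1.
- by move=> j _; exact: cond_mean_adapted.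
- by move=> x; apply: cond_mean0 => y; rewrite big_geq.
- by move=> x; apply: cond_mean0 => y; rewrite big_geq.
Qed.
End words.

(** * The phi-mixing coefficients *)

Section phi_coefficients.
Context d d' (T : measurableType d) (S : measurableType d') (R : realType).
Context (P : probability T R) (Z : int -> {mfun T >-> S}).

Lemma sigma_of_process_measurable (I : interval int) A :
  sigma_of_process Z I A -> measurable A.
Proof.
apply: smallest_sub; first exact: sigma_algebra_measurable.
by move=> _ [i _] [B mB <-]; exact: (measurable_funP (Z i)).
Qed.

Lemma sigma_of_process_sub (I J : interval int) : [set` I] `<=` [set` J] ->
  sigma_of_process Z I `<=` sigma_of_process Z J.
Proof.
move=> IJ; apply: sub_sigma_algebra2 => B [i /IJ Ji iB].
by exists i.
Qed.

Let values k := [set r : R | exists n : int, exists A B : set T,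
    [/\ sigma_of_process Z `]-oo, n] A, (0 < P A)%E,
        sigma_of_process Z `[k%:Z + n, +oo[ B
      & r = `| fine (P (A `&` B)) / fine (P A) - fine (P B) | ] ].

Let fine_prob A : measurable A -> P A = (fine (P A))%:E.
Proof. by move=> mA; rewrite fineK // fin_num_measure. Qed.

Let values_le1 k r : values k r -> r <= 1.
Proof.
move=> [n [A [B [/sigma_of_process_measurable mA PA
  /sigma_of_process_measurable mB ->]]]].
have mAB := measurableI _ _ mA mB.
have : (P (A `&` B) <= P A)%E by rewrite le_measure ?inE.
have := probability_le1 P mB; have : (0 <= P B)%E by [].
have : (0 <= P (A `&` B))%E by [].
move: PA; rewrite (fine_prob mA) (fine_prob mB) (fine_prob mAB).
rewrite !lee_fin lte_fin /=.
move: (fine (P (A `&` B))) (fine (P A)) (fine (P B)) => ab a b a0 ab0 b0 b1 aba.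
have : 0 <= ab / a by rewrite divr_ge0 // ltW.
have : ab / a <= 1 by rewrite ler_pdivrMr // mul1r.
by rewrite ler_norml => ? ?; apply/andP; split; lra.
Qed.

Let values_bounded k : has_ubound (values k).
Proof. by exists 1 => r; exact: values_le1. Qed.

Let values_neq0 k : values k !=set0.
Proof.
exists `| fine (P (setT `&` setT)) / fine (P setT) - fine (P setT) |.
exists 0, setT, setT; split => //.
- exact: (@measurableT _ (g_sigma_algebraType _)).
- by rewrite probability_setT lte01.
- exact: (@measurableT _ (g_sigma_algebraType _)).
Qed.

Lemma phi_coef_le1 k : phi_coef P Z k <= 1.
Proof. by apply: ge_sup; [exact: values_neq0|move=> r; exact: values_le1]. Qed.

Lemma phi_coef_ge0 k : 0 <= phi_coef P Z k.
Proof.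
have [r vr] := values_neq0 k.
apply: (@le_trans _ _ r); first by case: vr => n [A [B [_ _ _ ->]]].
exact: ub_le_sup (values_bounded k) _ vr.
Qed.

Lemma phi_coef_nonincreasing i j : (i <= j)%N ->
  phi_coef P Z j <= phi_coef P Z i.
Proof.
move=> ij; apply: ge_sup; first exact: values_neq0.
move=> r [n [A [B [sA PA sB re]]]]; apply: ub_le_sup; first exact: values_bounded.
exists n, A, B; split => //; apply: sigma_of_process_sub sB => k /=.
by rewrite !in_itv /= !andbT; apply: le_trans; rewrite lerD2r lez_nat.
Qed.

(** The form in which the supremum is used; unlike the quotient, it makes sense
    for [P A = 0]. *)
Lemma phi_coef_covariance k (n : int) A B :
  sigma_of_process Z `]-oo, n] A -> sigma_of_process Z `[k%:Z + n, +oo[ B ->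
  `| fine (P (A `&` B)) - fine (P A) * fine (P B) |
    <= phi_coef P Z k * fine (P A).
Proof.
move=> sA sB; have mA := sigma_of_process_measurable sA.
have mB := sigma_of_process_measurable sB.
have [PA0|PA0] := eqVneq (P A) 0%E.
  have -> : P (A `&` B) = 0%E.
    apply/eqP; rewrite eq_le measure_ge0 andbT -PA0 le_measure ?inE //.
    exact: measurableI.
  by rewrite PA0 /= mul0r subrr normr0 mulr0.
have PA : (0 < P A)%E by rewrite lt_neqAle eq_sym PA0 measure_ge0.
have a0 : 0 < fine (P A) by rewrite -lte_fin -fine_prob.
rewrite -ler_pdivrMr // -[X in _ / X]gtr0_norm // -normfV -normrM mulrBl.
rewrite [fine (P A) * _]mulrC mulfK ?gt_eqF //.
by apply: ub_le_sup; [exact: values_bounded|exists n, A, B].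
Qed.
End phi_coefficients.

(** * Random elements of a finite set *)

Section random_words.
Context d (T : measurableType d) (R : realType) (P : probability T R).
Context (Om : finType) (word : T -> Om).
Context (word_measurable : forall x, measurable [set t | word t = x]).

Definition law x : R := fine (P [set t | word t = x]).

Lemma law_ge0 x : 0 <= law x.
Proof. by rewrite /law fine_ge0. Qed.

Lemma word_indic_sum (f : Om -> R) t :
  f (word t) = \sum_x f x * \1_[set t | word t = x] t.
Proof.
rewrite (bigD1 (word t)) //= big1 ?addr0 => [|x xt].
  by rewrite indicE mem_set // mulr1.
by rewrite indicE memNset ?mulr0 // => /= e; rewrite e eqxx in xt.
Qed.

Lemma measurable_word (f : Om -> R) : measurable_fun setT (fun t => f (word t)).
Proof.
under eq_fun do rewrite word_indic_sum.
by apply: measurable_sum => x; apply: measurable_funM => //; exact: measurable_indic.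
Qed.

Lemma integral_word (f : Om -> R) : (forall x, 0 <= f x) ->
  (\int[P]_t (f (word t))%:E = (mean law f)%:E)%E.
Proof.
move=> f0.
under eq_integral do rewrite word_indic_sum -sumEFin.
rewrite ge0_integral_sum //; last 2 first.
- by move=> x; apply/measurable_EFinP/measurable_funM => //; exact: measurable_indic.
- by move=> x t _; rewrite lee_fin mulr_ge0.
rewrite /mean -sumEFin; apply: eq_bigr => x _.
have := @integralZl_indic _ _ _ P setT measurableT
  (fun=> [set t | word t = x]) (f x).
move=> -> //; last first.
  by move=> fx0; have := f0 x; rewrite leNgt fx0.
rewrite integral_indic // setIT EFinM muleC /law fineK //.
by rewrite fin_num_measure.
Qed.

Lemma prob_word (B : pred Om) : measurable [set t | B (word t)] ->
  P [set t | B (word t)] = (mass law B)%:E.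
Proof.
move=> mB; rewrite -[X in P X]setIT -integral_indic //.
have -> : mass law B = mean law (fun x => (B x)%:R).
  rewrite /mass /mean [LHS]big_mkcond; apply: eq_bigr => x _.
  by case: (B x); rewrite ?mulr1 ?mulr0.
rewrite -integral_word //; apply: eq_integral => t _.
rewrite indicE; congr ((_ : nat)%:R%:E); congr nat_of_bool.
by apply/idP/idP; rewrite inE.
Qed.

Lemma law_sum1 : \sum_x law x = 1.
Proof.
have mT : measurable [set t | predT (word t)].
  by rewrite (_ : [set t | _] = setT) //; apply/seteqP; split.
have := prob_word mT; rewrite (_ : [set t | _] = setT); last first.
  by apply/seteqP; split.
by rewrite probability_setT => -[->].
Qed.
End random_words.

Section coordinates.
Context (A : finType) (x0 : A) (N : nat).
Implicit Types (x : N.-tuple A).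

Definition letter i x : A := nth x0 x i.

(** The measurable structure on [T] is arbitrary, so that the lemma applies
    both to that of the probability space and to the one generated by a part of
    the process. *)
Lemma word_event_measurable d (T : measurableType d) (word : T -> N.-tuple A)
    (I : pred nat) (B : pred (N.-tuple A)) :
  (forall i k, (i < N)%N -> I i -> measurable [set t | letter i (word t) = k]) ->
  (forall x y, (forall i, (i < N)%N -> I i -> letter i x = letter i y) -> B x = B y) ->
  measurable [set t | B (word t)].
Proof.
move=> mX BI.
have -> : [set t | B (word t)] =
   \bigcup_(x in [set x | B x]) \bigcap_(i in [set i | (i < N)%N && I i])
      [set t | letter i (word t) = letter i x].
  apply/seteqP; split => [t Bt|t [x Bx xt] /=].
    by exists (word t).
  rewrite (BI _ x) // => i iN Ii; apply: xt => /=; exact/andP.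
apply: fin_bigcup_measurable => [|x _]; first exact: finite_finset.
apply: fin_bigcap_measurable => [|i /= /andP[iN Ii]]; last exact: mX.
by apply: sub_finite_set (finite_II N) => i /= /andP[].
Qed.
End coordinates.

(** * Quantization *)

Section bounded_expectation.
Context d (T : measurableType d) (R : realType) (P : probability T R).
Context (X : T -> R) (a b mu : R).
Context (X_meas : measurable_fun setT X) (X_range : forall t, a <= X t <= b)
  (X_mean : ('E_P[X] = mu%:E)%E).

Lemma bounded_expectation_shift : (\int[P]_t (X t - a)%:E = (mu - a)%:E)%E.
Proof.
have XI : X \in Lfun P 1.
  apply/Lfun1_integrable/measurable_bounded_integrable => //.
    by rewrite -ge0_fin_numE // fin_num_measure.
  exists (`|a| + `|b|); split; first exact: num_real.
  move=> M /ltW hM t _; apply: le_trans hM; rewrite /=.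
  have /andP[h1 h2] := X_range t.
  have := ler_norm b; have := ler_norm (- a); rewrite normrN.
  have := normr_ge0 a; have := normr_ge0 b.
  by move: `|a| `|b| => ? ? ? ? ? ?; rewrite ler_norml; apply/andP; split; lra.
have cI : cst a \in Lfun P 1.
  apply/Lfun1_integrable; exact: finite_measure_integrable_cst.
have := expectationB XI cI.
by rewrite X_mean expectation_cst -EFinB unlock.
Qed.

Lemma bounded_expectation_range : a <= mu <= b.
Proof.
have X0 t : 0 <= X t - a by rewrite subr_ge0; have /andP[] := X_range t.
have mX : measurable_fun setT (fun t => (X t - a)%:E).
  by apply/measurable_EFinP/measurable_funB.
apply/andP; split.
  rewrite -subr_ge0 -lee_fin -bounded_expectation_shift.
  by apply: integral_ge0 => t _; rewrite lee_fin.
rewrite -(lerD2r (- a)) -lee_fin -bounded_expectation_shift.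
have <- : (\int[P]_t (cst (b - a) t)%:E = (b - a)%:E)%E.
  by have := expectation_cst P (b - a); rewrite unlock.
apply: ge0_le_integral => //.
- by move=> t _; rewrite lee_fin.
- exact/measurable_EFinP/measurable_cst.
- by move=> t _; rewrite lee_fin lerD2r; have /andP[] := X_range t.
Qed.
End bounded_expectation.

Section quantization.
Context d d' (T : measurableType d) (S : measurableType d') (R : realType).
Context (P : probability T R) (Z : int -> {mfun T >-> S}).
Context (h : S -> R) (a b mu : R) (K N : nat).
Context (h_meas : measurable_fun setT h) (h_range : forall z, a <= h z <= b)
  (ab : a < b) (K_gt0 : (0 < K)%N)
  (h_mean : forall i, ('E_P[h \o Z i] = mu%:E)%E).

Definition level k : R := a + (b - a) * k%:R / K%:R.

Definition digit z : nat := Num.truncn ((h z - a) * K%:R / (b - a)).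

Let K0 : 0 < K%:R :> R. Proof. by rewrite ltr0n. Qed.
Let W0 : 0 < b - a. Proof. by rewrite subr_gt0. Qed.

Let u_ge0 z : 0 <= (h z - a) * K%:R / (b - a).
Proof.
by have /andP[h1 _] := h_range z; rewrite divr_ge0 ?mulr_ge0 ?subr_ge0 // ltW.
Qed.

Lemma digit_le z : (digit z <= K)%N.
Proof.
rewrite -(@natrK R K); apply: le_truncn.
rewrite ler_pdivrMr // mulrC ler_pM2l //.
by have /andP[_] := h_range z; lra.
Qed.

Lemma level_digit z : level (digit z) <= h z <= level (digit z) + (b - a) / K%:R.
Proof.
have := truncn_itv (u_ge0 z); rewrite -/(digit z) => /andP[h1 h2].
have {}h1 : (digit z)%:R * (b - a) / K%:R <= h z - a.
  by rewrite ler_pdivrMr // -ler_pdivlMr.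
have {}h2 : h z - a <= (digit z).+1%:R * (b - a) / K%:R.
  by rewrite ler_pdivlMr // -ler_pdivrMr // ltW.
have e1 : level (digit z) = a + (digit z)%:R * (b - a) / K%:R.
  by rewrite /level; ring.
have e2 : level (digit z) + (b - a) / K%:R = a + (digit z).+1%:R * (b - a) / K%:R.
  by rewrite /level -natr1; ring.
by rewrite e2 e1; apply/andP; split; lra.
Qed.

Lemma level_range k : (k <= K)%N -> a <= level k <= a + (b - a).
Proof.
move=> kK; rewrite /level lerDl lerD2l -mulrA.
rewrite mulr_ge0 ?divr_ge0 ?ler0n ?(ltW W0) //=.
by rewrite ler_piMr ?(ltW W0) // ler_pdivrMr // mul1r ler_nat.
Qed.

Lemma digit_measurable k : measurable [set z | digit z = k].
Proof.
have -> : [set z | digit z = k] =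
    setT `&` h @^-1` `[level k, level k.+1[.
  rewrite setTI; apply/seteqP; split => z /=.
    move=> e; have := truncn_itv (u_ge0 z); rewrite -/(digit z) e => /andP[h1 h2].
    rewrite in_itv /= /level; apply/andP; split.
      by move: h1; rewrite ler_pdivlMr // -ler_pdivrMr //; lra.
    by move: h2; rewrite ltr_pdivrMr // -ltr_pdivlMr //; lra.
  rewrite in_itv /= /level => /andP[h1 h2]; apply: truncn_def; apply/andP; split.
    by rewrite ler_pdivlMr // -ler_pdivrMr //; lra.
  by rewrite ltr_pdivrMr // -ltr_pdivlMr //; lra.
exact: h_meas.
Qed.

Definition zword t : N.-tuple 'I_K.+1 :=
  [tuple inord (digit (Z i.+1%:Z t)) | i < N].

Let X i (x : N.-tuple 'I_K.+1) := letter ord0 i x.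

Lemma letter_zword i t : (i < N)%N -> X i (zword t) = digit (Z i.+1%:Z t) :> nat.
Proof.
move=> iN; have := nth_mktuple (fun i : 'I_N => inord (digit (Z i.+1%:Z t)) : 'I_K.+1)
  ord0 (Ordinal iN).
by rewrite /X /letter /zword /= => ->; rewrite inordK // ltnS digit_le.
Qed.

Let letter_event i k : (i < N)%N -> [set t | X i (zword t) = k] =
   Z i.+1%:Z @^-1` [set z | digit z = k].
Proof.
move=> iN; apply/seteqP; split => t /= e; first by rewrite -letter_zword // e.
by apply/val_inj; rewrite /= letter_zword.
Qed.

Lemma letter_zword_sigma (I : interval int) i k : (i < N)%N -> i.+1%:Z \in I ->
  sigma_of_process Z I [set t | X i (zword t) = k].
Proof.
move=> iN iI; apply: sub_gen_smallest; exists i.+1%:Z => //.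
exists [set z | digit z = k]; first exact: digit_measurable.
by rewrite setTI letter_event.
Qed.

Lemma zword_event_measurable (B : pred (N.-tuple 'I_K.+1)) : measurable [set t | B (zword t)].
Proof.
apply: (@word_event_measurable _ ord0 N _ _ zword predT B) => [i k iN _|x y xy].
  rewrite -/(X i) letter_event // -[X in measurable X]setTI.
  exact/(measurable_funP (Z _))/digit_measurable.
congr B; apply: val_inj; apply: (@eq_from_nth _ ord0); rewrite ?size_tuple // => i iN.
exact: xy.
Qed.

Lemma zword_measurable x : measurable [set t | zword t = x].
Proof.
have := zword_event_measurable (pred1 x); congr measurable.
by apply/seteqP; split => t /= /eqP.
Qed.

Lemma zword_sigma (J : interval int) (I : pred nat) (B : pred (N.-tuple 'I_K.+1)) :
  (forall i, (i < N)%N -> I i -> i.+1%:Z \in J) ->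
  (forall x y, (forall i, (i < N)%N -> I i -> X i x = X i y) -> B x = B y) ->
  sigma_of_process Z J [set t | B (zword t)].
Proof.
move=> IJ BI; pose G := \bigcup_(i in [set` J]) preimage_set_system setT (Z i) measurable.
apply: (@word_event_measurable _ ord0 N _ (g_sigma_algebraType G) zword I B) => //.
by move=> i k iN Ii; apply: letter_zword_sigma => //; exact: IJ.
Qed.

Let w := law P zword.

Lemma zword_mixing k s (A B : pred (N.-tuple 'I_K.+1)) : (k <= s)%N ->
  adapted (past X k) A -> adapted (future X N s) B ->
  `| mass w (predI A B) - mass w A * mass w B |
    <= phi_coef P Z (s - k).+1 * mass w A.
Proof.
move=> ks cA sB.
have PE (C : pred (N.-tuple 'I_K.+1)) : fine (P [set t | C (zword t)]) = mass w C.
  by rewrite (prob_word P zword_measurable) //; exact: zword_event_measurable.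
have Xout i x y : (N <= i)%N -> X i x = X i y.
  by move=> Ni; rewrite /X /letter !nth_default ?size_tuple.
rewrite -!PE.
have -> : [set t | predI A B (zword t)] =
    [set t | A (zword t)] `&` [set t | B (zword t)].
  by apply/seteqP; split => t /= => [/andP[]|[-> ->]].
apply: (@phi_coef_covariance _ _ _ _ _ _ _ _ k%:Z).
- apply: (@zword_sigma _ (fun i => i < k)%N) => [i _ ik|x y e].
    by rewrite in_itv /= lez_nat.
  apply/cA/pastP => i ik; have [iN|Ni] := ltnP i N.
    exact: e.
  exact: Xout.
- apply: (@zword_sigma _ (fun i => s <= i)%N) => [i _ si|x y e].
    by rewrite in_itv /= andbT -PoszD lez_nat addSn ltnS subnK.
  by apply/sB/futureP => i si iN; exact: e.
Qed.

Let value i (x : N.-tuple 'I_K.+1) : R := level (X i x).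

Lemma zword_mean i : (i < N)%N ->
  `| mean w (value i) - mu | <= (b - a) / K%:R.
Proof.
move=> iN; have w1 := law_sum1 P zword_measurable : \sum_x w x = 1.
have mcst r := mean_cst r w1.
have vr x : a <= value i x by have /andP[] := level_range (ltn_ord (X i x)).
pose e := (b - a) / K%:R; have e0 : 0 <= e by rewrite divr_ge0 // ltW.
have mZ : measurable_fun setT (fun t => h (Z i.+1%:Z t) - a).
  apply: measurable_funB => //; exact: measurableT_comp.
have hZ : (\int[P]_t (h (Z i.+1%:Z t) - a)%:E = (mu - a)%:E)%E.
  apply: (bounded_expectation_shift (b := b)) (h_mean _) => [|t].
    exact: measurableT_comp.
  exact: h_range.
have vZ t : value i (zword t) <= h (Z i.+1%:Z t) <= value i (zword t) + e.
  by rewrite /value letter_zword //; exact: level_digit.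
have mf (g : N.-tuple 'I_K.+1 -> R) : measurable_fun setT (fun t => (g (zword t))%:E).
  exact/measurable_EFinP/measurable_word/zword_measurable.
have lo : mean w (fun x => value i x - a) <= mu - a.
  rewrite -lee_fin -hZ -(integral_word P zword_measurable); last by move=> x; rewrite subr_ge0.
  apply: ge0_le_integral => //.
  - by move=> t _; rewrite lee_fin subr_ge0.
  - exact: (mf (fun x => value i x - a)).
  - by apply/measurable_EFinP.
  - by move=> t _; rewrite lee_fin lerB //; have /andP[] := vZ t.
have hi : mu - a <= mean w (fun x => value i x - a + e).
  rewrite -lee_fin -hZ -(integral_word P zword_measurable); last by move=> x; rewrite addr_ge0 // subr_ge0.
  apply: ge0_le_integral => //.
  - by move=> t _; rewrite lee_fin subr_ge0; have /andP[+ _] := h_range (Z i.+1%:Z t).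
  - by apply/measurable_EFinP.
  - exact: (mf (fun x => value i x - a + e)).
  - by move=> t _; rewrite lee_fin; have /andP[_] := vZ t; lra.
move: lo hi; rewrite !meanD !mcst -/e ler_norml => lo hi.
by apply/andP; split; lra.
Qed.
End quantization.

(** * Concentration for the original process *)

Section phi_mixing_concentration.
Context d d' (T : measurableType d) (S : measurableType d') (R : realType).
Context (P : probability T R) (Z : int -> {mfun T >-> S}).
Context (h : S -> R) (a b mu : R) (L m : nat).
Context (h_meas : measurable_fun setT h) (h_range : forall z, a <= h z <= b)
  (ab : a < b) (L_gt0 : (0 < L)%N)
  (h_mean : forall i, ('E_P[h \o Z i] = mu%:E)%E).

Definition block_sum j t : R :=
  \sum_(j * L <= i < j.+1 * L) (h (Z i.+1%:Z t) - mu).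

Let N := (m * L)%N.
Let Phi := \sum_(0 <= k < N) phi_coef P Z k.+1.
Let scale : R := L%:R * (b - a).

Let L0 : 0 < L%:R :> R. Proof. by rewrite ltr0n. Qed.
Let W0 : 0 < b - a. Proof. by rewrite subr_gt0. Qed.
Let scale0 : 0 < scale. Proof. exact: mulr_gt0. Qed.

(** The exceptional set is an event of the quantized process.  Quantization and
    recentring move each normalized block sum by at most [2 / K], and [K] is
    chosen so that the total effect is at most [ell / 20]. *)
Lemma normalized_block_sum_concentration (delta : R) : 0 < delta ->
  delta < 1 / 3 -> 2 * ln delta^-1 < m%:R ->
  exists2 bad : set T, measurable bad /\ (P bad <= (3 * delta)%:E)%E &
   forall t, ~ bad t ->
   `|\sum_(0 <= j < m) (block_sum j t / scale)| <=
     Num.sqrt (2 * ln delta^-1) *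
       Num.sqrt (\sum_(0 <= j < m) (block_sum j t / scale) ^+ 2)
     + 4 * (Phi / L%:R) * (Num.sqrt (2 * ln delta^-1) * Num.sqrt m%:R)
     + (315 / 100 + 2 * (Phi / L%:R)) * ln delta^-1.
Proof.
move=> d0 d3 hm; set ell := ln delta^-1; set y := Num.sqrt (2 * ell).
set M := Num.sqrt m%:R.
have ell0 : 0 < ell.
  by rewrite /ell ln_gt0 // invf_gt1 //; apply: lt_trans d3 _; lra.
have y0 : 0 <= y by exact: sqrtr_ge0.
have M0 : 0 <= M by exact: sqrtr_ge0.
pose C := 40 * (m%:R + y * M) / ell.
have C0 : 0 <= C by rewrite divr_ge0 ?(ltW ell0) // mulr_ge0 // addr_ge0 // mulr_ge0.
pose K := (Num.truncn C).+1.
have K0 : 0 < K%:R :> R by rewrite ltr0n.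
have CK : C <= K%:R by have /andP[_ /ltW] := truncn_itv C0.
pose wd := zword Z h a b K N; pose w := law P wd.
pose X := @letter 'I_K.+1 ord0 N.
pose v i x : R := level a b K (X i x) / scale.
have v_adapted i x y' : X i x = X i y' -> v i x = v i y' by rewrite /v => ->.
have v_range i x : a / scale <= v i x <= a / scale + L%:R^-1.
  have -> : L%:R^-1 = (b - a) / scale by rewrite /scale; field; rewrite !gt_eqF.
  rewrite -mulrDl /v !ler_pM2r ?invr_gt0 //.
  by apply: level_range => //; rewrite -ltnS ltn_ord.
have mz := zword_measurable Z h_meas h_range ab (ltn0Sn _ : (0 < K)%N) (N := N).
have w1 : \sum_x w x = 1 by exact: law_sum1 mz.
have w_ge0 x : 0 <= w x by exact: law_ge0.
have main := @mixing_block_concentration R _ _ w w_ge0 w1 X N (phi_coef P Z)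
  m L v (a / scale) erefl L_gt0 (phi_coef_ge0 P Z) (phi_coef_le1 P Z 1)
  (fun i j (ij : (i <= j)%N) => phi_coef_nonincreasing P Z (ij : (i.+1 <= j.+1)%N))
  (@zword_mixing _ _ _ _ _ P Z h a b K N h_meas h_range ab isT)
  v_adapted v_range delta d0 d3 hm.
set B := (fun x => _ < _) in main.
exists [set t | B (wd t)].
  split; first exact: zword_event_measurable.
  by rewrite (prob_word P mz) ?lee_fin //; exact: zword_event_measurable.
move=> t /= /negP; rewrite -leNgt /= => {main}.
rewrite -/ell -/y -/M -/Phi.
set x := wd t.
pose s j := \sum_(j * L <= i < j.+1 * L) (v i x - mean w (v i)).
rewrite -/(s _).
pose g j := block_sum j t / scale.
have gs j : (j < m)%N -> `|g j - s j| <= 2 / K%:R.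
  move=> jm; rewrite /g /block_sum /s mulr_suml -sumrB.
  apply: (le_trans (ler_norm_sum _ _ _)).
  have -> : 2 / K%:R = \sum_(j * L <= i < j.+1 * L) (2 / K%:R / L%:R) :> R.
    by rewrite sumr_const_nat mulSn addnK -[RHS]mulr_natl; field; rewrite !gt_eqF.
  apply: ler_sum_nat => i /andP[_ ij].
  have iN : (i < N)%N by rewrite (leq_trans ij) // leq_mul2r jm orbT.
  have h1 := zword_mean h_meas h_range ab (ltn0Sn _ : (0 < K)%N) h_mean iN (P := P).
  have := level_digit h_range ab (ltn0Sn _ : (0 < K)%N) (Z i.+1%:Z t).
  rewrite -(letter_zword Z h_range ab (ltn0Sn _ : (0 < K)%N) t iN) -/wd -/x -/(X i x).
  move: h1; rewrite -/wd -/w -/X.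
  have -> : mean w (v i) = mean w (fun y => level a b K (X i y)) / scale.
    rewrite /v mulrC -meanZ; apply: eq_mean => z; exact: mulrC.
  rewrite /v; move: (mean w _) (level _ _ _ _) (h _) => me le hz h1 /andP[h2 h3].
  have -> : (hz - mu) / scale - (le / scale - me / scale) = ((hz - le) + (me - mu)) / scale.
    by ring.
  rewrite normrM normfV (ger0_norm (ltW scale0)) ler_pdivrMr //.
  have -> : 2 / K%:R / L%:R * scale = (b - a) / K%:R + (b - a) / K%:R.
    by rewrite /scale; field; rewrite !gt_eqF.
  apply: (le_trans (ler_normD _ _)); apply: lerD h1.
  by rewrite ger0_norm; lra.
have hsum : `|\sum_(0 <= j < m) g j| <= `|\sum_(0 <= j < m) s j| + m%:R * (2 / K%:R).
  have -> : \sum_(0 <= j < m) g j = \sum_(0 <= j < m) s j + \sum_(0 <= j < m) (g j - s j).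
    by rewrite -big_split /=; apply: eq_bigr => j _; rewrite addrC subrK.
  apply: (le_trans (ler_normD _ _)); rewrite lerD2l.
  apply: (le_trans (ler_norm_sum _ _ _)).
  have -> : m%:R * (2 / K%:R) = \sum_(0 <= j < m) (2 / K%:R) :> R.
    by rewrite sumr_const_nat subn0 mulr_natl.
  by apply: ler_sum_nat => j /andP[_]; exact: gs.
have hsq : Num.sqrt (\sum_(0 <= j < m) s j ^+ 2) <=
    Num.sqrt (\sum_(0 <= j < m) g j ^+ 2) + 2 / K%:R * M.
  have := @sqrt_sum_sqr_shift R m g (fun j => s j - g j) (2 / K%:R).
  under eq_bigr do rewrite addrC subrK.
  by apply=> [|j jm]; rewrite ?divr_ge0 // distrC gs.
have hK : (m%:R + y * M) * (2 / K%:R) <= 1 / 20 * ell.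
  rewrite mulrA ler_pdivrMr //.
  have := CK; rewrite /C ler_pdivrMr //; lra.
have hy := ler_wpM2l y0 hsq.
rewrite -/(g _) => hs; apply: (le_trans hsum).
lra.
Qed.
End phi_mixing_concentration.

(** * Studentization *)

Section studentization.
Context (R : realType).

(** The right-hand side of the last hypothesis depends on [S] when [U] is
    replaced by [U - S ^+ 2 / M ^+ 2], the sum of squares centred at the
    empirical mean; the inequality is solved for [|S|]. *)
Lemma studentized_bound (y M S U D : R) : 0 <= y -> y < M -> 
  S ^+ 2 <= M ^+ 2 * U ->
  `|S| <= y * Num.sqrt U + D ->
  `|S| <= (1 - y / M)^-1 * (y * Num.sqrt (U - S ^+ 2 / M ^+ 2) + D).
Proof.
move=> y0 yM SU hS; have M0 : 0 < M by apply: le_lt_trans yM.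
have h1 : 0 < 1 - y / M by rewrite subr_gt0 ltr_pdivrMr // mul1r.
rewrite -ler_pdivrMl ?invr_gt0 // invrK.
have V0 : 0 <= U - S ^+ 2 / M ^+ 2.
  by rewrite subr_ge0 ler_pdivrMr ?exprn_gt0 // mulrC.
have h2 : Num.sqrt U <= Num.sqrt (U - S ^+ 2 / M ^+ 2) + `|S| / M.
  have SM : 0 <= `|S| / M by rewrite divr_ge0 // ltW.
  rewrite -[leRHS]ger0_norm ?addr_ge0 ?sqrtr_ge0 // -[leRHS]sqrtr_sqr ler_wsqrtr //.
  rewrite sqrrD sqr_sqrtr // expr_div_n real_normK ?num_real //.
  have : 0 <= Num.sqrt (U - S ^+ 2 / M ^+ 2) * (`|S| / M) by rewrite mulr_ge0 ?sqrtr_ge0.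
  lra.
have := ler_wpM2l y0 h2.
have -> : y * (Num.sqrt (U - S ^+ 2 / M ^+ 2) + `|S| / M) =
  y * Num.sqrt (U - S ^+ 2 / M ^+ 2) + y / M * `|S| by ring.
by lra.
Qed.

Lemma sum_sqr_recentered (m L : nat) (s : nat -> R) (q : R) : (0 < m)%N -> (0 < L)%N ->
  let S := \sum_(0 <= j < m) s j in q = S / (m * L)%:R ->
  \sum_(0 <= j < m) (s j - L%:R * q) ^+ 2 =
    \sum_(0 <= j < m) s j ^+ 2 - S ^+ 2 / m%:R.
Proof.
move=> m0 L0 S ->.
have mn : m%:R != 0 :> R by rewrite pnatr_eq0 -lt0n.
have Ln : L%:R != 0 :> R by rewrite pnatr_eq0 -lt0n.
have -> : L%:R * (S / (m * L)%:R) = S / m%:R by rewrite natrM; field; rewrite mn.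
under eq_bigr do rewrite sqrrB.
rewrite big_split sumrB /= sumrMnl -mulr_suml -/S sumr_const_nat subn0 -mulr_natl.
by field.
Qed.
End studentization.

Section empirical_quantities.
Context d d' (T : measurableType d) (S : measurableType d') (R : realType).
Context (Z : int -> {mfun T >-> S}) (h : S -> R) (mu : R).

Lemma emp_mean_measurable n : measurable_fun setT h ->
  measurable_fun setT (emp_mean Z h n).
Proof.
move=> mh; apply: measurable_funM => //; apply: measurable_sum => i.
exact: measurableT_comp.
Qed.

Lemma Vhat_measurable n (l : R) : measurable_fun setT h ->
  measurable_fun setT (Vhat Z h n l).
Proof.
move=> mh; apply: measurable_funM => //; apply: measurable_sum => j.
have mS : measurable_fun setT (fun t => \sum_(i <- block (Num.truncn l) j)
    (h (Z i%:Z t) - Hbar Z h n l t)).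
  apply: measurable_sum => i; apply: measurable_funB.
    exact: measurableT_comp.
  exact: emp_mean_measurable.
by under eq_fun do rewrite expr2; exact: measurable_funM.
Qed.

Lemma emp_mean_center n t : (0 < n)%N ->
  emp_mean Z h n t - mu = (\sum_(0 <= i < n) (h (Z i.+1%:Z t) - mu)) / n%:R.
Proof.
move=> n0; rewrite /emp_mean big_add1 /= sumrB sumr_const_nat subn0 -mulr_natl.
by field; rewrite pnatr_eq0 -lt0n.
Qed.

Lemma Vhat_block_sums n (l : R) t :
  let L := Num.truncn l in let m := num_blocks n l in
  let total := \sum_(0 <= j < m) block_sum Z h mu L j t in
  (0 < n)%N -> (0 < L)%N -> (0 < m)%N ->
  n%:R * Vhat Z h n l t = \sum_(0 <= j < m) block_sum Z h mu L j t ^+ 2 - total ^+ 2 / m%:R.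
Proof.
move=> L m total n0 L0 m0.
have nn : n%:R != 0 :> R by rewrite pnatr_eq0 -lt0n.
rewrite -(sum_sqr_recentered (s := fun j => block_sum Z h mu L j t)
  (q := Hbar Z h n l t - mu) m0 L0); last first.
  rewrite /Hbar -/m -/L emp_mean_center ?muln_gt0 ?m0 //.
  by rewrite sum_nat_blocks // mul0n.
rewrite /Vhat mulrA divff // mul1r big_add1 /=; apply: eq_bigr => j _.
congr (_ ^+ 2); rewrite /block /= -/L big_add1 /= /block_sum.
have -> : L%:R * (Hbar Z h n l t - mu) =
    \sum_(j * L <= i < j.+1 * L) (Hbar Z h n l t - mu).
  by rewrite sumr_const_nat mulSn addnK mulr_natl.
by rewrite -sumrB; apply: eq_bigr => i _; ring.
Qed.
End empirical_quantities.

Unset Implicit Arguments.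
Set Strict Implicit.
Set Printing Implicit Defensive.

Theorem theorem2 (d d' : measure_display)
  (T : measurableType d) (S : measurableType d') (R : realType)
  (P : probability T R) (Z : int -> {mfun T >-> S})
  (Z_mixing : phi_mixing P Z)
  (a b mu : nat -> R) (h : nat -> S -> R)
  (h_meas : forall n : nat, (1 <= n)%N -> measurable_fun setT (h n))
  (h_range : forall n : nat, (1 <= n)%N -> forall z : S, a n <= h n z <= b n)
  (h_mean : forall n : nat, (1 <= n)%N -> forall i : int,
    ('E_P[h n \o Z i] = (mu n)%:E)%E)
  (l : nat -> R)
  (l_gt0 : forall n : nat, (1 <= n)%N -> 0 < l n)
  (l_incr : forall n p : nat, (1 <= n)%N -> (n <= p)%N -> l n <= l p)
  (l_infty : l n @[n --> \oo] --> +oo)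
  (l_littleo : (l : nat -> R^o) =o_\oo (fun n : nat => Num.sqrt n%:R : R^o))
  (xi : nat -> R)
  (xi_decr : forall n p : nat, (1 <= n)%N -> (n <= p)%N -> xi p <= xi n)
  (xi_to0 : xi n @[n --> \oo] --> (0 : R))
  (delta : R) (delta_gt0 : 0 < delta) (n : nat) (n_ge1 : (1 <= n)%N)
  (nu_tilde_defined : 2 * ln delta^-1 < (num_blocks n (l n))%:R) :
  ((1 - 3 * delta)%:E <=
    P [set t : T |
      `| emp_mean Z (h n) n t - mu n |
        <= nu_tilde n (l n) delta
             * (A_phi P Z (h n) (a n) (b n) n (l n) (xi n) delta t
                + B_phi P Z (a n) (b n) n (l n) delta)
           + (n%:R - (num_blocks n (l n) * Num.truncn (l n))%:R) / n%:R
             * (b n - a n) ]%R)%E.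
Proof.
(* for delta >= 1/3 the claimed lower bound is at most 0 *)
have [d3|d3] := leP (1 / 3) delta.
  by apply: le_trans (measure_ge0 _ _); rewrite lee_fin; lra.
set L := Num.truncn (l n); set m := num_blocks n (l n) in nu_tilde_defined *.
set ell := ln delta^-1 in nu_tilde_defined.
have ell0 : 0 < ell.
  by rewrite /ell ln_gt0 // invf_gt1 //; apply: lt_trans d3 _; lra.
have m0 : (0 < m)%N.
  by rewrite -(ltr_nat R); apply: lt_trans nu_tilde_defined; rewrite mulr_gt0.
have L0 : (0 < L)%N.
  by rewrite lt0n; apply: contraTneq m0 => Le; rewrite /m /num_blocks -/L Le divn0.
have n0 : 0 < n%:R :> R by rewrite ltr0n.
have mR : 0 < m%:R :> R by rewrite ltr0n.
have LR : 0 < L%:R :> R by rewrite ltr0n.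
have Nn : (m * L <= n)%N by exact: leq_trunc_div.
have Nn' : 0 <= n%:R - (m * L)%:R :> R by rewrite subr_ge0 ler_nat.
have [t0 _] : [set: T] !=set0.
  apply/set0P; apply/negP => /eqP T0.
  have := probability_setT P; rewrite T0 measure0 => -[] /eqP.
  by rewrite eq_sym oner_eq0.
have z0 := Z 0 t0.
have ab : a n <= b n by have /andP[] := h_range n n_ge1 z0; exact: le_trans.
have Phi0 : 0 <= Phi_sum P Z n by rewrite sumr_ge0 // => k _; exact: phi_coef_ge0.
set y := Num.sqrt (2 * ell); set M := Num.sqrt (m%:R : R).
have y0 : 0 <= y by exact: sqrtr_ge0.
have M0 : 0 < M by rewrite sqrtr_gt0.
have yM : y < M by rewrite ltr_sqrt.
have yME : Num.sqrt (2 * ell / m%:R) = y / M.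
  by rewrite sqrtrM ?mulr_ge0 ?(ltW ell0) // sqrtrV // ler0n.
have nu0 : 0 < 1 - y / M by rewrite subr_gt0 ltr_pdivrMr // mul1r.
have M2 : M ^+ 2 = m%:R by rewrite sqr_sqrtr // ler0n.
have xi0 : 0 <= xi n.
  rewrite -(cvg_lim (@Rhausdorff R) xi_to0); apply: limr_le.
    by apply/cvg_ex; exists 0.
  by exists n => // p /= np; exact: xi_decr.
have Vh0 t : 0 <= Vhat Z (h n) n (l n) t.
  by rewrite mulr_ge0 ?invr_ge0 ?ler0n // sumr_ge0 // => j _; exact: sqr_ge0.
have A_E t : n%:R * A_phi P Z (h n) (a n) (b n) n (l n) (xi n) delta t
    + n%:R * B_phi P Z (a n) (b n) n (l n) delta
  = y * Num.sqrt (n%:R * Vhat Z (h n) n (l n) t)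
    + (4 * (b n - a n) * Phi_sum P Z n * (y * M)
    + (315 / 100 * L%:R + 2 * Phi_sum P Z n) * (b n - a n) * ell
    + Num.sqrt (2 * ell * xi n)).
  have sq (r : R) : 0 <= r -> Num.sqrt (r / n%:R ^+ 2) = Num.sqrt r / n%:R.
    by move=> r0; rewrite sqrtrM // sqrtrV ?exprn_ge0 // sqrtr_sqr ger0_norm.
  have e0 : 0 <= 2 * ell by rewrite mulr_ge0 // ltW.
  rewrite /A_phi /B_phi -/ell -/m -/L !sq ?mulr_ge0 ?ler0n ?(ltW ell0) ?Vh0 //.
  have -> : 2 * ell * (n%:R^-1 * Vhat Z (h n) n (l n) t) =
     2 * ell * (n%:R * Vhat Z (h n) n (l n) t) / n%:R ^+ 2.
    by field; rewrite gt_eqF.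
  rewrite (sq _ (mulr_ge0 e0 (mulr_ge0 (ler0n _ _) (Vh0 t)))) !(sqrtrM _ e0) -/y -/M.
  by field; rewrite gt_eqF.
pose rad t := nu_tilde n (l n) delta *
   (A_phi P Z (h n) (a n) (b n) n (l n) (xi n) delta t
                + B_phi P Z (a n) (b n) n (l n) delta)
           + (n%:R - (m * L)%:R) / n%:R * (b n - a n).
have radE t : n%:R * rad t = (1 - y / M)^-1 *
   (y * Num.sqrt (n%:R * Vhat Z (h n) n (l n) t)
    + (4 * (b n - a n) * Phi_sum P Z n * (y * M)
    + (315 / 100 * L%:R + 2 * Phi_sum P Z n) * (b n - a n) * ell
    + Num.sqrt (2 * ell * xi n))) + (n%:R - (m * L)%:R) * (b n - a n).
  rewrite -A_E /rad /nu_tilde -/ell -/m yME.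
  by move: (1 - y / M)^-1 => nu; field; rewrite gt_eqF.
have good_measurable : measurable [set t : T | `|emp_mean Z (h n) n t - mu n| <= rad t].
  rewrite -[X in measurable X]setTI; apply: measurable_fun_le => //.
    apply: measurableT_comp => //; apply: measurable_funB => //.
    exact/emp_mean_measurable/h_meas.
  apply: measurable_funD => //; apply: measurable_funM => //.
  apply: measurable_funD => //; apply: measurable_funD => //.
  apply: measurable_funD => //.
  apply: (measurableT_comp (continuous_measurable_fun (@sqrt_continuous R))).
  apply: measurable_funM => //; apply: measurable_funM => //.
  exact/Vhat_measurable/h_meas.
(* if a n = b n then h n is constant and cannot be normalized by its range *)
have [abE|abn] := eqVneq (a n) (b n).
  rewrite (_ : [set t | _] = setT) ?probability_setT ?lee_fin; first by lra.
  apply/seteqP; split => // t _ /=; rewrite -/(rad t).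
  have hE z : h n z = a n.
    by have := h_range n n_ge1 z; rewrite -abE => /le_anti.
  have muE : mu n = a n.
    have := h_mean n n_ge1 0; rewrite (_ : h n \o Z 0 = cst (a n)).
      by rewrite expectation_cst => -[<-].
    by apply/funext => z /=; exact: hE.
  rewrite emp_mean_center // big1 => [|i _]; last by rewrite hE muE subrr.
  rewrite mul0r normr0 -(pmulr_rge0 _ n0) radE.
  rewrite -abE subrr !(mulr0, mul0r) addr0 add0r.
  rewrite mulr_ge0 ?invr_ge0 ?(ltW nu0) // addr_ge0 ?sqrtr_ge0 // mulr_ge0 ?sqrtr_ge0 //.
have {}ab : a n < b n by rewrite lt_neqAle abn.
have W0 : 0 < b n - a n by rewrite subr_gt0.
have [bad [bad_measurable Pbad] hbad] :=
  normalized_block_sum_concentration (h_meas n n_ge1) (h_range n n_ge1) ab L0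
    (h_mean n n_ge1) delta_gt0 d3 nu_tilde_defined.
apply: (@le_trans _ _ (P (~` bad))).
  rewrite probability_setC // EFinB leeB //.
apply: le_measure; rewrite ?inE //; first exact: measurableC.
move=> t /hbad {hbad}; rewrite /= -/(rad t) -/ell -/y -/M.
pose s j := block_sum Z (h n) (mu n) L j t.
set Phi := \sum_(0 <= k < m * L) phi_coef P Z k.+1.
have Phi_le : Phi <= Phi_sum P Z n.
  rewrite /Phi /Phi_sum big_add1 /= [leRHS](big_cat_nat _ (n := (m * L)%N)) //=.
  by rewrite lerDl sumr_ge0 // => k _; exact: phi_coef_ge0.
set u := L%:R * (b n - a n).
have u0 : 0 < u by rewrite mulr_gt0.
rewrite -mulr_suml normrM normfV (ger0_norm (ltW u0)).
have -> : \sum_(0 <= j < m) (block_sum Z (h n) (mu n) L j t / u) ^+ 2 =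
    (\sum_(0 <= j < m) s j ^+ 2) / u ^+ 2.
  by rewrite mulr_suml; apply: eq_bigr => j _; rewrite expr_div_n.
have U0 : 0 <= \sum_(0 <= j < m) s j ^+ 2 by apply: sumr_ge0 => j _; exact: sqr_ge0.
rewrite sqrtrM // sqrtrV ?exprn_ge0 ?(ltW u0) // sqrtr_sqr (ger0_norm (ltW u0)).
rewrite ler_pdivrMr // => hS.
set tot := \sum_(0 <= j < m) block_sum Z (h n) (mu n) L j t in hS.
have {}hS : `|tot| <= y * Num.sqrt (\sum_(0 <= j < m) s j ^+ 2) +
   (4 * (b n - a n) * Phi_sum P Z n * (y * M)
    + (315 / 100 * L%:R + 2 * Phi_sum P Z n) * (b n - a n) * ell
    + Num.sqrt (2 * ell * xi n)).
  apply: le_trans hS _.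
  have -> : (y * (Num.sqrt (\sum_(0 <= j < m) s j ^+ 2) / u) +
      4 * (Phi / L%:R) * (y * M) + (315 / 100 + 2 * (Phi / L%:R)) * ell) * u =
    y * Num.sqrt (\sum_(0 <= j < m) s j ^+ 2) +
   (4 * (b n - a n) * (y * M) * Phi
    + (315 / 100 * L%:R) * (b n - a n) * ell + 2 * (b n - a n) * ell * Phi).
    by rewrite /u; field; rewrite !gt_eqF.
  rewrite lerD2l.
  have h1 : 4 * (b n - a n) * (y * M) * Phi <= 4 * (b n - a n) * (y * M) * Phi_sum P Z n.
    by rewrite ler_wpM2l // !mulr_ge0 // ltW.
  have h2 : 2 * (b n - a n) * ell * Phi <= 2 * (b n - a n) * ell * Phi_sum P Z n.
    by rewrite ler_wpM2l // !mulr_ge0 // ltW.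
  have := sqrtr_ge0 (2 * ell * xi n); lra.
have totU : tot ^+ 2 <= M ^+ 2 * \sum_(0 <= j < m) s j ^+ 2.
  have := sum_norm_le_sqrt m s; rewrite -/M => h1.
  have h2 : `|tot| <= M * Num.sqrt (\sum_(0 <= j < m) s j ^+ 2).
    by apply: le_trans h1; exact: ler_norm_sum.
  rewrite -(sqr_sqrtr U0) -exprMn -[tot ^+ 2]real_normK ?num_real //.
  by rewrite ler_pXn2r ?nnegrE // mulr_ge0 ?sqrtr_ge0.
have := studentized_bound y0 yM totU hS.
rewrite M2 -(Vhat_block_sums Z (h n) (mu n) t n_ge1 L0 m0) => hT.
rewrite -(ler_pM2l n0) radE.
have -> : n%:R * `|emp_mean Z (h n) n t - mu n| =
    `|tot + \sum_((m * L)%N <= i < n) (h n (Z i.+1%:Z t) - mu n)|.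
  rewrite -[X in X * _ = _](ger0_norm (ltW n0)) -normrM emp_mean_center //.
  rewrite mulrC divfK ?gt_eqF // (big_cat_nat _ (n := (m * L)%N)) //=.
  by rewrite -(mul0n L) -sum_nat_blocks.
apply: (le_trans (ler_normD _ _)); apply: lerD hT _.
have mu_range : a n <= mu n <= b n.
  apply: bounded_expectation_range (h_mean n n_ge1 0) => [|t']; last exact: h_range.
  exact/measurableT_comp/measurable_funP/h_meas.
apply: (le_trans (ler_norm_sum _ _ _)).
have -> : (n%:R - (m * L)%:R) * (b n - a n) = \sum_((m * L)%N <= i < n) (b n - a n).
  by rewrite sumr_const_nat -[RHS]mulr_natl natrB.
apply: ler_sum => i _; have /andP[h1 h2] := h_range n n_ge1 (Z i.+1%:Z t).
move: mu_range => /andP[h3 h4].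
by rewrite ler_norml; apply/andP; split; lra.
Qed.
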